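(* Let $\mu$ be a stationary white-noise functional such that with probability one the following holds: for any distinct $w_1,\dots,w_n\in\mathbb{Z}^d$ $$\mu\Big(\bigcup_{i=1}^nB_{w_i}\Big)=\sum_{i=1}^n\mu(B_{w_i}).\qquad(\mathrm{a})$$ Suppose that there exists a family of random variables $Y_v(w)\ge0$, $v,w\in\mathbb{Z}^d$, such that $$|\Delta_v(B_w)|\le Y_v(w)\qquad(\mathrm{b})$$ and $$\mathbb{E}[Y_v(w)]+\mathbb{E}\big[Y_v(w)^{2+\epsilon}\big]\le c\,(1+|v-w|)^{-(3d+\delta)}\qquad(\mathrm{c})$$ for some $\epsilon,\delta,c>0$ independent of $v,w$. Then $\mu$ satisfies the following three conditions: (Stabilisation) there exists a random variable $\Delta_0$ such that for any sequence of cubes $D_n:=v_n+\Lambda_n$ ($v_n\in\mathbb{Z}^d$) satisfying $\liminf_nD_n=\mathbb{R}^d$ we have $\Delta_0(D_n)\to\Delta_0$ in probability as $n\to\infty$; (Bounded moments) there exists $\epsilon'>0$ such that $\sup_{v\in\mathbb{Z}^d,n\in\mathbb{N}}\mathbb{E}[|\Delta_v(\Lambda_n)|^{2+\epsilon'}]<\infty$; (Moment decay) there exist $c',\epsilon',\zeta>0$ and $\gamma>\max\{d,\zeta\}$ such that for all $n\in\mathbb{N}$ and $v\in\mathbb{Z}^d\setminus\Lambda_n$, $\mathbb{E}\big[|\Delta_v(\Lambda_n)|+|\Delta_v(\Lambda_n)|^{2+\epsilon'}\big]\le c'\,n^\zeta\,\mathrm{dist}(v,\Lambda_n)^{-\gamma}$.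 If we replace (a) and (b) with the weaker assumption that for any $D:=u+\Lambda_n$ (where $u\in\mathbb{Z}^d$, $n\in\mathbb{N}$) $$|\Delta_v(D)|\le\sum_{w\in\mathbb{Z}^d\cap D}Y_v(w),$$ where $Y_v(w)$ again satisfies (c), then $\mu$ satisfies the bounded moments and moment decay conditions.
   Context: A Gaussian white noise $W$ on $\mathbb{R}^d$ is a centred Gaussian process indexed by $L^2(\mathbb{R}^d)$ with $\mathbb{E}[W(g)W(h)]=\int gh\,dx$; for a Borel set $A$ of finite Lebesgue measure $W(A):=W(\mathbf{1}_A)$. For $v\in\mathbb{Z}^d$ let $B_v=v+[0,1]^d$. Let $W'$ be an independent copy of $W$ and let $\widetilde W^{(v)}(A)=W(A\setminus B_v)+W'(A\cap B_v)$ be $W$ with its restriction to $B_v$ resampled independently. $\Lambda_n=[-n,n]^d$; $\mathrm{dist}$ is Euclidean distance. A stationary white-noise functional is a family of random variables $\mu(D)=F(D,W)$, where $D$ ranges over sets $v+\Lambda_n$ ($v\in\mathbb{Z}^d$, $n\in\mathbb{N}$), and, where needed, over finite unions of unit cubes $B_w$, $w\in\mathbb{Z}^d$, with $F$ a deterministic functional such that $F(u+v+\Lambda_n,W(\cdot-u))=F(v+\Lambda_n,W)$ for all $u,v\in\mathbb{Z}^d$, $n\in\mathbb{N}$, where $W(\cdot-u)$ denotes $A\mapsto W(A-u)$. Its differences are $\Delta_v(D)=F(D,W)-F(D,\widetilde W^{(v)})$. *)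

(* Defs.v *)
From HB Require Import structures.
From mathcomp Require Import all_boot all_order all_algebra.
From mathcomp Require Import all_classical all_reals all_analysis.
Set Implicit Arguments.
Unset Strict Implicit.
Unset Printing Implicit Defensive.
Import Order.TTheory GRing.Theory Num.Theory.
Import numFieldNormedType.Exports.
Local Open Scope classical_set_scope.
Local Open Scope ring_scope.

(* R^d is the type d.-tuple R with its product (that is, Borel) sigma-algebra,
   and Z^d is the type {ffun 'I_d -> int}. The library has no Lebesgue measure
   on R^d: it is built by induction on d, as the image of the product of the
   Lebesgue measures on R and on R^n under (a, t) |-> a :: t. The lemma
   lebesgue_box gives its value on boxes, which determines it. *)

Section lebesgue_cons.
Context (R : realType) (n : nat)
  (m : {sigma_finite_measure set (n.-tuple R) -> \bar R}).

Let cons_pair (x : measurableTypeR R * n.-tuple R) : n.+1.-tuple R :=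
  [tuple of x.1 :: x.2].

Let measurable_cons_pair : measurable_fun setT cons_pair.
Proof. exact: measurable_cons. Qed.

Definition lebesgue_cons : set (n.+1.-tuple R) -> \bar R :=
  pushforward (@lebesgue_measure R \x m)%E cons_pair.

Let measurable_preimage A : measurable A -> measurable (cons_pair @^-1` A).
Proof. by move=> mA; rewrite -[X in measurable X]setTI; exact: measurable_cons_pair. Qed.

Let lebesgue_cons0 : lebesgue_cons set0 = 0%E.
Proof. by rewrite /lebesgue_cons /pushforward preimage_set0 measure0. Qed.

Let lebesgue_cons_ge0 A : (0 <= lebesgue_cons A)%E.
Proof. exact: measure_ge0. Qed.

Let lebesgue_cons_sigma_additive : semi_sigma_additive lebesgue_cons.
Proof.
move=> F mF tF mUF; rewrite /lebesgue_cons /pushforward preimage_bigcup.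
apply: measure_semi_sigma_additive => [k||].
- exact: measurable_preimage.
- apply/trivIsetP => /= i j _ _ ij; rewrite -preimage_setI.
  by move/trivIsetP : tF => /(_ _ _ _ _ ij) ->//; rewrite preimage_set0.
- by rewrite -preimage_bigcup; exact: measurable_preimage.
Qed.

HB.instance Definition _ := isMeasure.Build _ _ _ lebesgue_cons
  lebesgue_cons0 lebesgue_cons_ge0 lebesgue_cons_sigma_additive.

Let sigma_finite_lebesgue_cons : sigma_finite setT lebesgue_cons.
Proof.
have /sigma_finiteP[F [FT ndF mF]] := sigma_finiteT (@lebesgue_measure R).
have /sigma_finiteP[G [GT ndG mG]] := sigma_finiteT m.
pose u (t : n.+1.-tuple R) : measurableTypeR R * n.-tuple R :=
  (thead t, [tuple of behead t]).
have uK x : u (cons_pair x) = x by case: x => a t; congr pair; exact/val_inj.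
have umeas : measurable_fun setT u.
  apply/measurable_fun_pair; first exact: measurable_tnth.
  exact: measurable_behead.
exists (fun k => u @^-1` (F k `*` G k)).
  apply/esym/seteqP; split => // t _.
  have [i _ Fi] : (\bigcup_i F i) (u t).1 by rewrite -FT.
  have [j _ Gj] : (\bigcup_j G j) (u t).2 by rewrite -GT.
  exists (maxn i j) => //; split.
    by move: Fi; exact/subsetPset/ndF/leq_maxl.
  by move: Gj; exact/subsetPset/ndG/leq_maxr.
move=> k; have [mFk Fk] := mF k; have [mGk Gk] := mG k; split.
  by rewrite -[X in measurable X]setTI; apply: umeas => //; exact: measurableX.
rewrite /lebesgue_cons /pushforward -comp_preimage.
rewrite (_ : u \o cons_pair = id); last by apply/funext => x; exact: uK.
by rewrite preimage_id product_measure1E// lte_mul_pinfty// ge0_fin_numE.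
Qed.

HB.instance Definition _ :=
  Measure_isSigmaFinite.Build _ _ _ lebesgue_cons sigma_finite_lebesgue_cons.

End lebesgue_cons.

Fixpoint lebesgue (R : realType) (d : nat) :
    {sigma_finite_measure set (d.-tuple R) -> \bar R} :=
  match d with
  | 0 => \d_([tuple] : 0.-tuple R)
  | n.+1 => lebesgue_cons (lebesgue R n)
  end.

Lemma lebesgue_box (R : realType) (d : nat) (a b : 'I_d -> R) :
  (forall i, a i <= b i) ->
  lebesgue R d [set x | forall i, a i <= tnth x i <= b i] =
  (\prod_(i < d) (b i - a i))%:E.
Proof.
elim: d a b => [|d IH] a b ab.
  rewrite big_ord0 /= diracE mem_set//= => -[]//.
rewrite big_ord_recl /= /lebesgue_cons /pushforward.
rewrite (_ : _ @^-1` _ = `[a ord0, b ord0] `*`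
  [set x : d.-tuple R | forall i, a (lift ord0 i) <= tnth x i <= b (lift ord0 i)]).
  rewrite product_measure1E//; last first.
    rewrite (_ : [set _ | _] =
      \bigcap_(i in [set: 'I_d]) ((@tnth d R ^~ i) @^-1` `[a (lift ord0 i), b (lift ord0 i)])).
      apply: fin_bigcap_measurable => // i _.
      rewrite -[X in measurable X]setTI; apply: measurable_tnth => //.
    apply/seteqP; split => x /= h i; first by move=> _; rewrite /= in_itv/=; exact: h.
    by have := h i I; rewrite /= in_itv/=.
  rewrite (IH (fun i => a (lift ord0 i)) (fun i => b (lift ord0 i)))//.
  rewrite [X in (X * _)%E]lebesgue_measure_itv/= lte_fin EFinM.
  by case: ltgtP (ab ord0) => // ->; rewrite ?subrr// mul0e mul0r.
apply/seteqP; split => -[x t] /=.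
  move=> h; split; first by have := h ord0; rewrite /= in_itv/= tnth0.
  by move=> i; have := h (lift ord0 i); rewrite tnthS.
rewrite in_itv/= => -[h1 h2] i; have [j ->|->] := unliftP ord0 i.
  by rewrite tnthS.
by rewrite tnth0.
Qed.

Definition lim_inf_set (T : Type) (A : nat -> set T) : set T :=
  \bigcup_n \bigcap_(j >= n) A j.

Notation lattice d := {ffun 'I_d -> int}.

Section geometry.
Context (R : realType) (d : nat).
Implicit Types (u v w : lattice d) (x y : d.-tuple R) (A D : set (d.-tuple R)).

Definition embed v : d.-tuple R := [tuple (v i)%:~R | i < d].

Definition translate v A : set (d.-tuple R) :=
  [set [tuple tnth x i + (v i)%:~R | i < d] | x in A].

Definition unit_cube v : set (d.-tuple R) :=
  translate v [set x | forall i, 0 <= tnth x i <= 1].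

Definition cubes (s : seq (lattice d)) : set (d.-tuple R) :=
  \bigcup_(w in [set` s]) unit_cube w.

Definition Lambda (n : nat) : set (d.-tuple R) :=
  [set x | forall i, - n%:R <= tnth x i <= n%:R].

Definition box v (n : nat) : set (d.-tuple R) := translate v (Lambda n).

Definition eucl x y : R :=
  Num.sqrt (\sum_(i < d) (tnth x i - tnth y i) ^+ 2).

Definition dist x A : R := inf [set eucl x y | y in A].

Definition finite_borel : set (set (d.-tuple R)) :=
  [set A | measurable A /\ (lebesgue R d A < +oo)%E].

Definition L2 : set (d.-tuple R -> R) :=
  [set h | h \in Lfun (lebesgue R d) 2%:E].

End geometry.

(* Sigma-algebra on the functions I -> R generated by the evaluations at the
   elements of D. Its members, and the functions measurable with respect to it,
   only depend on the restriction of the argument to D; this is why processes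
   indexed by a set D are represented below by functions on the whole of I. *)
Definition cylinder (R : realType) (I : Type) (D : set I) :
    set (set (I -> R)) :=
  <<s [set E | exists2 i, D i &
        exists2 B : set R, measurable B & E = [set w | B (w i)]] >>.

Section processes.
Context (R : realType) (disp : measure_display) (T : measurableType disp)
  (P : probability T R).

(* Degenerate (constant) variables are Gaussian; they are listed separately
   because normal_prob m 0 is not a Dirac mass in the library. *)
Definition gaussian (X : T -> R) : Prop :=
  measurable_fun setT X /\
  ((exists m : R, {ae P, forall t, X t = m}) \/
   exists m s : R, 0 < s /\
     forall B : set R, measurable B -> P (X @^-1` B) = normal_prob m s B).

Definition gaussian_process (I : Type) (D : set I) (X : I -> T -> R) : Prop :=
  forall (k : nat) (i : 'I_k -> I) (a : 'I_k -> R), (forall j, D (i j)) ->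
    gaussian (fun t => \sum_(j < k) a j * X (i j) t).

Definition independent_copy (I : Type) (D : set I) (X X' : I -> T -> R) :
    Prop :=
  [/\ forall i, D i -> measurable_fun setT (X' i),
      forall E : set (I -> R), cylinder D E ->
        P [set t | E (X'^~ t)] = P [set t | E (X^~ t)] &
      forall E E' : set (I -> R), cylinder D E -> cylinder D E' ->
        P [set t | E (X^~ t) /\ E' (X'^~ t)] =
        (P [set t | E (X^~ t)] * P [set t | E' (X'^~ t)])%E].

Definition cvg_in_probability (X : nat -> T -> R) (Y : T -> R) : Prop :=
  forall e : R, 0 < e ->
    P [set t | e <= `|X n t - Y t|] @[n --> \oo] --> 0%E.

End processes.

Section white_noise_functionals.
Context (R : realType) (d : nat).

Definition noise := set (d.-tuple R) -> R.

Definition shift_noise (u : lattice d) (w : noise) : noise :=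
  fun A => w (translate (- u) A).

Definition resample (v : lattice d) (w w' : noise) : noise :=
  fun A => w (A `\` unit_cube v) + w' (A `&` unit_cube v).

Definition measurable_functional (f : noise -> R) : Prop :=
  forall B : set R, measurable B -> cylinder (@finite_borel R d) (f @^-1` B).

Context (disp : measure_display) (T : measurableType disp)
  (P : probability T R).
Local Open Scope ereal_scope.

Definition white_noise (W : (d.-tuple R -> R) -> T -> R) : Prop :=
  [/\ gaussian_process P (@L2 R d) W,
      forall h, L2 h -> 'E_P[W h] = 0 &
      forall g h, L2 g -> L2 h ->
        'E_P[fun t => (W g t * W h t)%R] =
        \int[lebesgue R d]_x (g x * h x)%:E].

(* The noise of a set A is W A := W(1_A); it is only meaningful for A in
   finite_borel, and measurable functionals depend on no other value. *)
Definition set_noise (W : (d.-tuple R -> R) -> T -> R) (t : T) : noise :=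
  fun A => W (\1_A) t.

Context (W W' : (d.-tuple R -> R) -> T -> R) (F : set (d.-tuple R) -> noise -> R).

Definition mu (D : set (d.-tuple R)) (t : T) : R := F D (set_noise W t).

Definition Delta (v : lattice d) (D : set (d.-tuple R)) (t : T) : R :=
  (F D (set_noise W t) -
   F D (resample v (set_noise W t) (set_noise W' t)))%R.

(* Cubes Lambda n are considered for n >= 1 only: Lambda 0 is a point, and
   n `^ zeta would vanish in the moment decay. Relations between random
   variables are understood almost surely. *)
Definition stationary_functional : Prop :=
  (forall (v : lattice d) n, (0 < n)%N -> measurable_functional (F (box v n)))
  /\
  forall (u v : lattice d) n, (0 < n)%N ->
    {ae P, forall t, F (box (u + v)%R n) (shift_noise u (set_noise W t)) =
                     F (box v n) (set_noise W t)}.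

Definition defined_on_cubes : Prop :=
  forall s : seq (lattice d), s != [::] ->
    measurable_functional (F (cubes s)).

(* Distinct w_1, .., w_n with n >= 1 are given as a nonempty duplicate-free
   sequence. *)
Definition additive_on_cubes : Prop :=
  {ae P, forall t, forall s : seq (lattice d), s != [::] -> uniq s ->
    mu (cubes s) t = (\sum_(w <- s) mu (unit_cube w) t)%R}.

Definition majorants (Y : lattice d -> lattice d -> {RV P >-> R})
    (eps delta c : R) : Prop :=
  (forall v w, {ae P, forall t, (0 <= Y v w t)%R}) /\
  forall v w,
    'E_P[Y v w] + 'E_P[fun t => (Y v w t `^ (2 + eps))%R] <=
    (c * (1 + eucl (embed R v) (embed R w)) `^ (- (3 * d%:R + delta)))%:E.

Definition stabilisation : Prop :=
  exists Delta0 : {RV P >-> R}, forall v : nat -> lattice d,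
    lim_inf_set (fun n => box (v n) n) = [set: d.-tuple R] ->
    cvg_in_probability P (fun n => Delta 0%R (box (v n) n)) Delta0.

Definition bounded_moments : Prop :=
  exists eps : R, (0 < eps)%R /\
    ereal_sup [set e | exists v n, (0 < n)%N /\
      e = 'E_P[fun t => (`|Delta v (Lambda n) t| `^ (2 + eps))%R]] < +oo.

Definition moment_decay : Prop :=
  exists c eps zeta gamma : R,
    [/\ (0 < c)%R, (0 < eps)%R, (0 < zeta)%R,
        (Num.max d%:R zeta < gamma)%R &
        forall n (v : lattice d), (0 < n)%N -> ~ Lambda n (embed R v) ->
          'E_P[fun t => (`|Delta v (Lambda n) t| +
                         `|Delta v (Lambda n) t| `^ (2 + eps))%R] <=
          (c * n%:R `^ zeta * dist (embed R v) (Lambda n) `^ (- gamma))%:E].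

End white_noise_functionals.

(* Main.v *)
Require Import Defs.
From HB Require Import structures.
From mathcomp Require Import all_boot all_order all_algebra.
From mathcomp Require Import all_classical all_reals all_analysis.
From mathcomp Require Import measurable_realfun zify ring lra.
Set Implicit Arguments.
Unset Strict Implicit.
Unset Printing Implicit Defensive.
Import Order.TTheory GRing.Theory Num.Theory.
Import numFieldNormedType.Exports.
Local Open Scope classical_set_scope.
Local Open Scope ring_scope.

(** The moment bounds only use the majorants. The box Lambda_n contains
    (2 n + 1) ^ d lattice points w, and |Delta_v (Lambda_n)| is at most the sum of
    the Y_v(w) over them. Let p = 2 + min (eps, 1), so that 2 < p <= 3 and
    E[Y_v(w) ^ p] <= c (1 + |v - w|) ^ - (3 d + delta). For positive weights b_w,
    Jensen's inequality bounds (sum y_w) ^ p by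
    (sum b_w) ^ (p - 1) times the sum of the b_w (y_w / b_w) ^ p
    (lemma [powR_sum_weighted]). With b_w = (1 + |v - w|) ^ - (d + delta / 3) all sums
    converge over the lattice ([lattice_sum_le]), which gives the bounded moments.
    With b_w = 1 and 1 + |v - w| >= dist (v, Lambda_n) it gives the moment decay, for
    zeta = 3 d and gamma = 3 d + delta.

    When mu is additive on cubes, the domination of Delta_v (Lambda_n) must be
    deduced from that of the Delta_v (B_w), and additivity is assumed for the noise W
    only. It is an almost sure property of the restriction of W to Borel sets of
    finite measure, so it passes to the resampled noise because the latter has the
    same law ([resample_law]); hence Delta_v of a box is almost surely the sum of the
    Delta_v of its unit cubes ([Delta_cubes]).

    The equality of laws rests on two facts. First, for finitely many sets A_j, the
    combination sum a_j W(A_j) and its resampled version have the same law: in the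
    second, the part outside the cube is independent of the part inside, both are
    centred Gaussian, and variances add up as they do for W ([integral_normal_conv],
    [gaussian_centred_normal]). Second, the laws of linear combinations determine the
    law of the process ([eq_law_of_cos]): the closure of the functions
    cos (theta + sum a_j w(A_j)) under linear combinations and bounded pointwise
    limits is an algebra that contains the indicators of all cylinder sets.

    For the stabilisation, the differences of the unit cubes are dominated by
    majorants with summable first moments, hence their sum over the whole lattice
    converges absolutely, almost surely and in mean. This sum is the limit: the
    difference of a box is a partial sum, and what is missing is controlled by the
    tail of a convergent series as soon as the box contains a given finite set of
    unit cubes ([random_series]). *)

(** * Integrals against normal densities *)

Section normal_density_integrals.
Context (R : realType).
Local Notation leb := (@lebesgue_measure R).
Implicit Types (m s t a c x z : R).

Let measurable_EFin_comp (f : R -> R) : measurable_fun [set: R] f ->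
  measurable_fun [set: measurableTypeR R] (fun x => (f x)%:E).
Proof. by move=> mf; exact/measurable_EFinP. Qed.


(** Integration against a normal law is integration against its density. *)
Lemma ge0_integral_normal_prob m s (f : measurableTypeR R -> \bar R) :
  measurable_fun setT f -> (forall x, 0 <= f x)%E ->
  (\int[normal_prob m s]_x f x = \int[leb]_x (f x * (normal_pdf m s x)%:E))%E.
Proof.
move=> mf f0.
have dom : normal_prob m s `<< leb := normal_prob_dominates m s.
rewrite -(Radon_Nikodym_SigmaFinite.change_of_variables dom f0)//.
have fi := Radon_Nikodym_SigmaFinite.f_integrable dom.
apply: ae_eq_integral => //.
- by apply: emeasurable_funM => //; exact: (measurable_int leb).
- apply: emeasurable_funM => //; apply/measurable_EFinP.
  exact: measurable_normal_pdf.
- apply: ae_eqe_mul2l; apply: integral_ae_eq => //.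
    by apply/measurable_EFinP; exact: measurable_normal_pdf.
  by move=> E _ mE; rewrite -Radon_Nikodym_SigmaFinite.f_integral.
Qed.

Lemma normal_pdf_expE m s x : s != 0 ->
  normal_pdf m s x = normal_peak s * expR (- (x - m) ^+ 2 / (s ^+ 2 *+ 2)).
Proof. by move=> s0; rewrite normal_pdfE. Qed.

(** The moment generating function of a normal law. Completing the square turns
    the tilted density into the density of another normal law, so no change of
    variables is needed. *)
Lemma integral_expR_normal_prob m s a : s != 0 ->
  (\int[normal_prob m s]_x (expR (a * x))%:E =
   (expR (a * m + a ^+ 2 * s ^+ 2 / 2))%:E)%E.
Proof.
move=> s0; rewrite ge0_integral_normal_prob; last 2 first.
- have mexp : measurable_fun [set: R] (fun x => expR (a * x)).
    by apply: measurableT_comp => //; exact: measurable_funM.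
  exact: measurable_EFin_comp.
- by move=> x; rewrite lee_fin expR_ge0.
under eq_integral => x _.
  rewrite -EFinM (_ : expR (a * x) * _ = expR (a * m + a ^+ 2 * s ^+ 2 / 2) *
      normal_pdf (m + a * s ^+ 2) s x); first over.
  rewrite !normal_pdf_expE// mulrCA [RHS]mulrCA -!expRD; congr (_ * expR _).
  by field.
under eq_integral do rewrite EFinM.
rewrite integralZl//=; last exact: integrable_normal_pdf.
by rewrite integral_normal_pdf mule1.
Qed.

Lemma ge0_integral_affine s c (G : R -> R) : 0 < s ->
  continuous G -> (forall x, 0 <= G x) ->
  (\int[leb]_x (G x)%:E = \int[leb]_x (G (s * x + c) * s)%:E)%E.
Proof.
move=> s0 cG G0.
pose F (x : R^o) : R^o := (x + c / s) * s.
have FE x : F x = s * x + c.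
  by rewrite /F mulrDl divfK ?gt_eqF// mulrC.
have dF (x : R^o) : is_derive x (1 : R^o) F s.
  by apply: is_derive_eq; rewrite /= addr0 scaler0 add0r; exact: mulr1.
have F'E : F^`()%classic = cst s.
  by apply/funext => x; rewrite derive1E derive_val.
rewrite (@increasing_ge0_integration_by_substitutionT R F G)//.
- by apply: eq_integral => x _; rewrite F'E/= -FE.
- by move=> x y xy; rewrite /F ltr_pM2r// ltrD2r.
- by rewrite F'E => x; exact: cvg_cst.
- by rewrite F'E; exact: is_cvg_cst.
- by rewrite F'E; exact: is_cvg_cst.
- by apply/gt0_cvgMlNy => //; exact: cvg_addrr_Ny.
- by apply/gt0_cvgMly => //; exact: cvg_addrr.
Qed.


(** Completing the square in x: as a function of x, the product of the two
    centred densities is a multiple of a normal density. *)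
Lemma normal_pdfM s t x z : 0 < s -> 0 < t ->
  let r := Num.sqrt (s ^+ 2 + t ^+ 2) in
  normal_pdf 0 s x * normal_pdf 0 t (z - x) =
  normal_pdf 0 r z * normal_pdf (z * s ^+ 2 / r ^+ 2) (s * t / r) x.
Proof.
move=> s0 t0 r.
have r20 : 0 < s ^+ 2 + t ^+ 2 by rewrite addr_gt0// exprn_gt0.
have r0 : 0 < r by rewrite sqrtr_gt0.
have r2 : r ^+ 2 = s ^+ 2 + t ^+ 2 by rewrite sqr_sqrtr// ltW.
have q0 : 0 < s * t / r by rewrite divr_gt0// mulr_gt0.
rewrite !normal_pdf_expE ?gt_eqF// mulrACA [RHS]mulrACA -!expRD; congr (_ * expR _).
  rewrite /normal_peak -!invfM -!sqrtrM; last 2 first.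
  - by rewrite mulrn_wge0// mulr_ge0 ?pi_ge0// sqr_ge0.
  - by rewrite mulrn_wge0// mulr_ge0 ?pi_ge0// sqr_ge0.
  congr (Num.sqrt _)^-1; rewrite !expr_div_n exprMn.
  by field; rewrite gt_eqF.
rewrite !subr0 !expr_div_n exprMn r2.
field; rewrite !gt_eqF//.
Qed.

(** Convolution of two centred normal laws: variances add up. *)
Lemma integral_normal_conv s t (G : R -> R) : 0 < s -> 0 < t ->
  continuous G -> (forall x, 0 <= G x) ->
  (\int[leb]_x \int[leb]_y
     (G (x + y) * (normal_pdf 0 s x * normal_pdf 0 t y))%:E =
   \int[leb]_z (G z * normal_pdf 0 (Num.sqrt (s ^+ 2 + t ^+ 2)) z)%:E)%E.
Proof.
move=> s0 t0 cG G0; set r := Num.sqrt _.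
have mp u m : measurable_fun [set: R] (normal_pdf m u) by exact: measurable_normal_pdf.
have mG : measurable_fun [set: R] G by exact: continuous_measurable_fun.
pose H (p : measurableTypeR R * measurableTypeR R) : \bar R :=
  (G p.2 * (normal_pdf 0 s p.1 * normal_pdf 0 t (p.2 - p.1)))%:E.
have mH : measurable_fun setT H.
  apply/measurable_EFinP; apply: measurable_funM.
    by apply: (measurableT_comp mG); exact: measurable_snd.
  apply: measurable_funM.
    by apply: (measurableT_comp (mp s 0)); exact: measurable_fst.
  apply: (measurableT_comp (mp t 0)); apply: measurable_funB.
    exact: measurable_snd.
  exact: measurable_fst.
have H0 p : (0 <= H p)%E by rewrite lee_fin !mulr_ge0// normal_pdf_ge0.
transitivity (\int[leb]_x \int[leb]_z H (x, z))%E.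
  apply: eq_integral => x _.
  pose K y := G (x + y) * (normal_pdf 0 s x * normal_pdf 0 t y).
  rewrite (@ge0_integral_affine 1 (- x) K)//.
  - by apply: eq_integral => z _; rewrite /K /H/= mul1r mulr1 subrKC.
  - move=> y; rewrite /K; apply: cvgM.
      apply: (cvg_comp _ G); last exact: cG.
      by apply: cvgD; [exact: cvg_cst|exact: cvg_id].
    apply: cvgM; first exact: cvg_cst.
    by apply: continuous_normal_pdf; rewrite gt_eqF.
  - by move=> y; rewrite /K !mulr_ge0// normal_pdf_ge0.
rewrite fubini_tonelli//; apply: eq_integral => z _.
under eq_integral do rewrite /H/= normal_pdfM// mulrA EFinM.
rewrite ge0_integralZl//=.
- by rewrite integral_normal_pdf mule1.
- by apply: measurable_EFin_comp; exact: mp.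
- by move=> x _; rewrite lee_fin normal_pdf_ge0.
- by rewrite lee_fin mulr_ge0// normal_pdf_ge0.
Qed.

Lemma sqr_le_expRD x : x ^+ 2 <= 4 * (expR x + expR (- x)).
Proof.
wlog x0 : x / 0 <= x.
  move=> h; have [|x0] := leP 0 x; first exact: h.
  have /h : 0 <= - x by rewrite oppr_ge0 ltW.
  by rewrite sqrrN opprK addrC.
have h : (1 + x / 2) ^+ 2 <= expR x.
  rewrite [in leRHS](_ : x = x / 2 + x / 2); last by field.
  rewrite expRD -expr2 lerXn2r ?nnegrE ?expR_ge0//.
    by rewrite addr_ge0// divr_ge0.
  exact: expR_ge1Dx.
have := expR_ge0 (- x).
by nra.
Qed.

(** The second moment of N(0, s^2) is proportional to s^2. The value of the
    constant plays no role below: it only has to be positive and finite. *)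
Lemma second_moment_normal_prob : exists k : R, 0 < k /\
  forall s, 0 < s ->
    (\int[normal_prob 0 s]_x (x ^+ 2)%:E = (s ^+ 2 * k)%:E)%E.
Proof.
have m2 : measurable_fun [set: R] (fun x : R => x ^+ 2) by exact: measurable_funX.
have mp u m : measurable_fun [set: R] (normal_pdf m u) by exact: measurable_normal_pdf.
pose K := (\int[leb]_x (x ^+ 2 * normal_pdf 0 1 x)%:E)%E.
have scaleK s : 0 < s ->
    (\int[normal_prob 0 s]_x (x ^+ 2)%:E = (s ^+ 2)%:E * K)%E.
  move=> s0; rewrite ge0_integral_normal_prob; last 2 first.
  - exact: measurable_EFin_comp.
  - by move=> x; rewrite lee_fin sqr_ge0.
  under eq_integral do rewrite -EFinM.
  rewrite (@ge0_integral_affine s 0 (fun x => x ^+ 2 * normal_pdf 0 s x))//; last 2 first.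
  - move=> x; apply: cvgM; first exact: sqr_continuous.
    by apply: continuous_normal_pdf; rewrite gt_eqF.
  - by move=> x; rewrite mulr_ge0 ?sqr_ge0 ?normal_pdf_ge0.
  rewrite -ge0_integralZl//=; last 3 first.
  - by apply: measurable_EFin_comp; apply: measurable_funM; [exact: m2|exact: mp].
  - by move=> x _; rewrite lee_fin mulr_ge0 ?sqr_ge0 ?normal_pdf_ge0.
  - by rewrite lee_fin sqr_ge0.
  apply: eq_integral => x _; rewrite addr0 -EFinM; congr (_%:E).
  rewrite !normal_pdf_expE ?gt_eqF// !subr0 expr1n.
  have -> : normal_peak s = normal_peak 1 / s.
    rewrite /normal_peak -[in RHS](gtr0_norm s0) -sqrtr_sqr -invfM -sqrtrM; last first.
      by rewrite mulrn_wge0// mulr_ge0 ?pi_ge0// sqr_ge0.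
    by congr (Num.sqrt _)^-1; ring.
  have -> : - (s * x) ^+ 2 / (s ^+ 2 *+ 2) = - x ^+ 2 / (1 *+ 2).
    by field; rewrite gt_eqF.
  by field; rewrite gt_eqF.
have Koo : (K < +oo)%E.
  have -> : K = (\int[normal_prob 0 1]_x (x ^+ 2)%:E)%E.
    by rewrite scaleK// expr1n mul1e.
  have me a : measurable_fun [set: R] (fun x => expR (a * x)).
    by apply: measurableT_comp => //; exact: measurable_funM.
  apply: (@le_lt_trans _ _ (\int[normal_prob 0%R 1%R]_x
      (4%:E * ((expR (1 * x))%:E + (expR (-1 * x))%:E)))%E).
    apply: ge0_le_integral => //=.
    - by move=> x _; rewrite lee_fin sqr_ge0.
    - exact: measurable_EFin_comp.
    - apply: measurable_funeM; apply: emeasurable_funD; exact: measurable_EFin_comp.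
    - by move=> x _; rewrite lee_fin mul1r mulN1r; exact: sqr_le_expRD.
  rewrite ge0_integralZl//=; last 2 first.
  - apply: emeasurable_funD; exact: measurable_EFin_comp.
  - by move=> x _; rewrite lee_fin addr_ge0 ?expR_ge0.
  rewrite ge0_integralD//=; last 2 first.
  - exact: measurable_EFin_comp.
  - exact: measurable_EFin_comp.
  by rewrite !integral_expR_normal_prob// -EFinD -EFinM ltry.
have K0 : (0 < K)%E.
  rewrite lt_def integral_ge0 ?andbT; last first.
    by move=> x _; rewrite lee_fin mulr_ge0 ?sqr_ge0 ?normal_pdf_ge0.
  apply/eqP => K0.
  have mf : measurable_fun [set: R] (fun x => (x ^+ 2 * normal_pdf 0 1 x)%:E).
    by apply/measurable_EFinP; exact: measurable_funM.
  have : ae_eq leb setT (fun x => (x ^+ 2 * normal_pdf 0 1 x)%:E) (cst 0%E).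
    apply/ae_eq_integral_abs => //; rewrite -[RHS]K0.
    apply: eq_integral => x _; rewrite gee0_abs// lee_fin.
    by rewrite mulr_ge0 ?sqr_ge0 ?normal_pdf_ge0.
  move=> h.
  have : (\int[leb]_x (normal_pdf 0 1 x)%:E = \int[leb]_x 0)%E.
    apply: ae_eq_integral => //; first exact: measurable_EFin_comp.
    have h0 : {ae leb, forall x, x != 0 :> R}.
      exists [set 0]; split => //; first exact: lebesgue_measure_set1.
      by move=> x /= /negP; rewrite negbK => /eqP.
    apply: filterS2 h h0 => x /= hx x0 _.
    move: (hx I) => -[] /eqP; rewrite mulf_eq0 sqrf_eq0 (negbTE x0)/= => /eqP ->.
    by [].
  by rewrite integral_normal_pdf integral0 => /eqP; rewrite eqe oner_eq0.
exists (fine K); split; first by rewrite fine_gt0// K0.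
by move=> s s0; rewrite scaleK// [in RHS]EFinM fineK// ge0_fin_numE// ltW.
Qed.

End normal_density_integrals.

(** * Centred normal random variables *)

Section centred_normal_variables.
Context (R : realType) (d : measure_display) (T : measurableType d)
  (P : probability T R).
Local Notation leb := (@lebesgue_measure R).
Implicit Types (X Y : T -> R) (s v : R) (G : R -> R).

(** The law of a random element with values in any measurable space. *)
Lemma exists_pushforward d' (T' : measurableType d') (Z : T -> T') :
  measurable_fun [set: T] Z ->
  exists m : {measure set T' -> \bar R}, forall B, m B = P (Z @^-1` B).
Proof.
move=> mZ.
pose Z' : {RV P >-> T'} :=
  HB.pack_for {mfun T >-> T'} Z (isMeasurableFun.Build _ _ _ _ Z mZ).
by exists (distribution P Z').
Qed.

Lemma ge0_integral_law d' (T' : measurableType d') (Z : T -> T')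
    (nu : {measure set T' -> \bar R}) (f : T' -> \bar R) :
  measurable_fun [set: T] Z ->
  (forall B, measurable B -> P (Z @^-1` B) = nu B) ->
  measurable_fun [set: T'] f -> (forall x, 0 <= f x)%E ->
  (\int[P]_w f (Z w) = \int[nu]_x f x)%E.
Proof.
move=> mZ ZE mf f0.
pose Z' : {RV P >-> T'} :=
  HB.pack_for {mfun T >-> T'} Z (isMeasurableFun.Build _ _ _ _ Z mZ).
have /= <- := ge0_integral_distribution Z' mf f0.
by apply: eq_measure_integral => A mA _; exact: ZE.
Qed.

(** X has the Gaussian law of mean 0 and standard deviation s. The case s = 0 is
    the Dirac mass at 0, which [normal_prob 0 0] is not. *)
Definition centred_normal X s := measurable_fun [set: T] X /\
  ((s = 0 /\ {ae P, forall t, X t = 0}) \/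
   (0 < s /\ forall B : set R, measurable B -> P (X @^-1` B) = normal_prob 0 s B)).

(** The expectation of G under the law described by [centred_normal _ s]. *)
Definition normal_expectation G s : \bar R :=
  if s == 0 then (G 0)%:E else (\int[leb]_z (G z * normal_pdf 0 s z)%:E)%E.

Lemma ge0_integral_centred_normal X s G : centred_normal X s ->
  continuous G -> (forall x, 0 <= G x) ->
  (\int[P]_t (G (X t))%:E = normal_expectation G s)%E.
Proof.
move=> [mX h] cG G0.
have mG : measurable_fun [set: R] G by exact: continuous_measurable_fun.
rewrite /normal_expectation; case: h => [[-> X0]|[s0 XE]].
  rewrite eqxx (@ge0_ae_eq_integral _ _ _ P _ _ (cst (G 0)%:E))//.
  - by rewrite integral_cst//= probability_setT mule1.
  - by apply/measurable_EFinP; exact: (measurableT_comp mG).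
  - by move=> x _; rewrite lee_fin.
  - by move=> x _; rewrite lee_fin.
  - by apply: filterS X0 => t Xt _; rewrite Xt.
have mEG : measurable_fun [set: measurableTypeR R] (EFin \o G).
  exact/measurable_EFinP.
have EG0 x : (0 <= (EFin \o G) x)%E by rewrite /= lee_fin.
rewrite gt_eqF// (@ge0_integral_law _ (measurableTypeR R) X (normal_prob 0 s) _ mX XE mEG EG0).
by rewrite ge0_integral_normal_prob.
Qed.

(** A Gaussian variable of mean 0 is centred normal, with a standard deviation
    that depends only on its second moment. The mean m of a non-degenerate normal
    law is 0 because 1 + a X <= exp (a X) gives 0 <= a m + a^2 s^2 / 2 for all
    a. *)
Lemma gaussian_centred_normal : exists k : R, 0 < k /\
  forall X v, gaussian P X -> ('E_P[X] = 0)%E ->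
    ('E_P[fun t => (X t * X t)%R] = v%:E)%E -> centred_normal X (Num.sqrt (v / k)).
Proof.
have [k [k0 kE]] := second_moment_normal_prob R.
exists k; split=> // X v [mX gX] EX EXX; split=> //.
have m2 : measurable_fun [set: measurableTypeR R] (fun x : R => (x ^+ 2)%:E).
  by apply/measurable_EFinP; exact: measurable_funX.
have mXX : measurable_fun [set: T] (fun t => X t * X t) by exact: measurable_funM.
have iXX : P.-integrable [set: T] (EFin \o (fun t => X t * X t)).
  apply/integrableP; split; first exact/measurable_EFinP.
  under eq_integral => t _ do rewrite /= ger0_norm -?expr2 ?sqr_ge0// expr2.
  by move: EXX; rewrite unlock => ->; rewrite ltry.
have v0 : 0 <= v.
  rewrite -lee_fin -EXX unlock; apply: integral_ge0 => t _.
  by rewrite lee_fin -expr2 sqr_ge0.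
have iX : P.-integrable [set: T] (EFin \o X).
  have i1 : P.-integrable [set: T] (EFin \o (fun t => 1 + X t * X t)).
    rewrite (_ : _ \o _ = (fun w : T =>
      (cst 1%:E w + (EFin \o (fun t : T => (X t * X t)%R)) w)%E))//.
    apply: integrableD => //.
    exact: finite_measure_integrable_cst.
  apply: le_integrable i1 => //; first exact/measurable_EFinP.
  move=> t _ /=; rewrite lee_fin [leRHS]ger0_norm; last first.
    by rewrite addr_ge0// -expr2 sqr_ge0.
  have := sqr_ge0 (`|X t| - 1).
  have : `|X t| * `|X t| = X t * X t by rewrite -normrM ger0_norm// -expr2 sqr_ge0.
  have := normr_ge0 (X t).
  by nra.
case: gX => [[m Xm]|[m [s [s0 XE]]]].
  left.
  have m0 : m = 0.
    apply: EFin_inj; rewrite -[RHS]EX unlock.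
    rewrite (@ae_eq_integral _ _ _ P _ (cst m%:E))//.
    - by rewrite integral_cst//= probability_setT mule1.
    - exact/measurable_EFinP.
    - by apply: filterS Xm => t Xt _; rewrite /= Xt.
  have X0 : {ae P, forall t, X t = 0} by rewrite -m0.
  split=> //.
  have -> : v = 0.
    apply: EFin_inj; rewrite -[LHS]EXX unlock.
    rewrite (@ae_eq_integral _ _ _ P _ (cst 0%:E))//.
    - by rewrite integral_cst//= probability_setT mule1.
    - exact/measurable_EFinP.
    - by apply: filterS X0 => t Xt _; rewrite /= Xt mulr0.
  by rewrite mul0r sqrtr0.
right.
have mexp a : measurable_fun [set: R] (fun x => expR (a * x)).
  by apply: measurableT_comp => //; exact: measurable_funM.
have Eexp a : (\int[P]_t (expR (a * X t))%:E =
    (expR (a * m + a ^+ 2 * s ^+ 2 / 2))%:E)%E.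
  rewrite -integral_expR_normal_prob ?gt_eqF//.
  rewrite (@ge0_integral_law _ (measurableTypeR R) X (normal_prob m s)
    (fun x => (expR (a * x))%:E))//.
    by apply/measurable_EFinP; exact: mexp.
have m0 : m = 0.
  have h a : 0 <= a * m + a ^+ 2 * s ^+ 2 / 2.
    rewrite -ler_expR expR0 -lee_fin -Eexp.
    have -> : 1%:E = (\int[P]_t (1%:E + a%:E * (X t)%:E))%E.
      rewrite integralD//=; last 2 first.
      - exact: finite_measure_integrable_cst.
      - exact: integrableZl.
      rewrite integralZl// integral_cst//= probability_setT.
      by move: EX; rewrite unlock => ->; rewrite mule0 adde0 mule1.
    apply: le_integral => //.
    - apply: integrableD => //; first exact: finite_measure_integrable_cst.
      exact: integrableZl.
    - apply/integrableP; split.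
        apply/measurable_EFinP; apply: measurableT_comp => //.
        exact: measurable_funM.
      under eq_integral => t _ do rewrite /= ger0_norm ?expR_ge0//.
      by rewrite Eexp ltry.
    - by move=> t _; rewrite -EFinM -EFinD lee_fin expR_ge1Dx.
  (* the quadratic a m + a^2 s^2 / 2 is minimal at a = - m / s^2 *)
  have := h (- m / s ^+ 2).
  have -> : - m / s ^+ 2 * m + (- m / s ^+ 2) ^+ 2 * s ^+ 2 / 2 = - (m ^+ 2 / (s ^+ 2 * 2)).
    by field; rewrite gt_eqF.
  rewrite oppr_ge0 pmulr_lle0 ?invr_gt0 ?mulr_gt0 ?exprn_gt0// => m2le0.
  by apply/eqP; rewrite -sqrf_eq0 eq_le m2le0 sqr_ge0.
subst m.
have vE : v = s ^+ 2 * k.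
  apply: EFin_inj; rewrite -kE// -EXX unlock.
  rewrite -(@ge0_integral_law _ (measurableTypeR R) X (normal_prob 0 s) (fun x => (x ^+ 2)%:E))//.
  by move=> x; rewrite lee_fin sqr_ge0.
have -> : Num.sqrt (v / k) = s.
  by rewrite vE mulfK ?gt_eqF// sqrtr_sqr gtr0_norm.
by split.
Qed.

(** Fubini for independent variables: their joint law is the product law, since
    the two agree on rectangles. *)
Lemma ge0_integral_indep (X Y : T -> R)
    (nu1 nu2 : {finite_measure set (measurableTypeR R) -> \bar R})
    (f : measurableTypeR R * measurableTypeR R -> \bar R) :
  measurable_fun [set: T] X -> measurable_fun [set: T] Y ->
  (forall B : set R, measurable B -> P (X @^-1` B) = nu1 B) ->
  (forall B : set R, measurable B -> P (Y @^-1` B) = nu2 B) ->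
  (forall B C : set R, measurable B -> measurable C ->
     P (X @^-1` B `&` Y @^-1` C) = P (X @^-1` B) * P (Y @^-1` C))%E ->
  measurable_fun setT f -> (forall x, 0 <= f x)%E ->
  (\int[P]_t f (X t, Y t) = \int[nu1]_x \int[nu2]_y f (x, y))%E.
Proof.
move=> mX mY XE YE XY mf f0.
have mXY : measurable_fun [set: T]
    (fun w : T => (X w, Y w) : measurableTypeR R * measurableTypeR R).
  exact: measurable_fun_pair.
have [m mE] := exists_pushforward mXY.
rewrite -fubini_tonelli1//.
rewrite -(@ge0_integral_law _ _ _ (nu1 \x nu2)%E f mXY)// => A mA.
rewrite -mE; apply/esym; apply: product_measure_unique => // B C mB mC.
transitivity (P (X @^-1` B) * P (Y @^-1` C))%E; first by rewrite mE -XY.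
by rewrite XE// YE.
Qed.

(** The sum of two independent centred normal variables is centred normal, stated
    for expectations of nonnegative continuous functions. *)
Lemma ge0_integral_centred_normalD X Y s s' G :
  centred_normal X s -> centred_normal Y s' ->
  (forall B C : set R, measurable B -> measurable C ->
     P (X @^-1` B `&` Y @^-1` C) = P (X @^-1` B) * P (Y @^-1` C))%E ->
  continuous G -> (forall x, 0 <= G x) ->
  (\int[P]_w (G (X w + Y w))%:E =
   normal_expectation G (Num.sqrt (s ^+ 2 + s' ^+ 2)))%E.
Proof.
move=> nX nY XY cG G0.
have mG : measurable_fun [set: R] G by exact: continuous_measurable_fun.
have [mX hX] := nX; have [mY hY] := nY.
have mXY : measurable_fun [set: T] (fun t => X t + Y t) by exact: measurable_funD.
have mGf (f : T -> R) : measurable_fun [set: T] f ->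
    measurable_fun [set: T] (fun w => (G (f w))%:E).
  by move=> mf; apply/measurable_EFinP; exact: (measurableT_comp mG).
case: hX => [[s0 X0]|[s0 XE]].
  have s'0 : 0 <= s' by case: hY => [[->]|[/ltW]].
  rewrite s0 expr0n add0r sqrtr_sqr ger0_norm// -(ge0_integral_centred_normal nY)//.
  apply: ge0_ae_eq_integral => //; [exact: mGf|exact: mGf| | |].
  - by move=> w _; rewrite lee_fin.
  - by move=> w _; rewrite lee_fin.
  - by apply: filterS X0 => w -> _; rewrite add0r.
case: hY => [[s'0 Y0]|[s'0 YE]].
  rewrite s'0 expr0n addr0 sqrtr_sqr gtr0_norm// -(ge0_integral_centred_normal nX)//.
  apply: ge0_ae_eq_integral => //; [exact: mGf|exact: mGf| | |].
  - by move=> w _; rewrite lee_fin.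
  - by move=> w _; rewrite lee_fin.
  - by apply: filterS Y0 => w -> _; rewrite addr0.
rewrite /normal_expectation gt_eqF; last first.
  by rewrite sqrtr_gt0 addr_gt0 ?exprn_gt0.
rewrite -integral_normal_conv//.
pose f (p : measurableTypeR R * measurableTypeR R) : \bar R := (G (p.1 + p.2))%:E.
have mf : measurable_fun setT f.
  apply/measurable_EFinP; apply: (measurableT_comp mG).
  by apply: measurable_funD; [exact: measurable_fst|exact: measurable_snd].
have f0 p : (0 <= f p)%E by rewrite lee_fin.
rewrite (@ge0_integral_indep X Y (normal_prob 0 s) (normal_prob 0 s') f)//.
have mp u : measurable_fun [set: measurableTypeR R] (fun x : R => (normal_pdf 0 u x)%:E).
  by apply/measurable_EFinP; exact: measurable_normal_pdf.
have mfx x : measurable_fun [set: measurableTypeR R] (fun y : R => (G (x + y))%:E).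
  by apply/measurable_EFinP; apply: (measurableT_comp mG); exact: measurable_funD.
rewrite ge0_integral_normal_prob; last 2 first.
- exact: measurable_fun_fubini_tonelli_F.
- by move=> x; apply: integral_ge0 => y _.
apply: eq_integral => x _.
rewrite ge0_integral_normal_prob; [|exact: mfx|by []].
rewrite -ge0_integralZr//.
- by apply: eq_integral => y _; rewrite /f/= -!EFinM; congr (_%:E); ring.
- by apply: emeasurable_funM; [exact: mfx|exact: mp].
- by move=> y _; rewrite mule_ge0// lee_fin normal_pdf_ge0.
- by rewrite lee_fin normal_pdf_ge0.
Qed.

End centred_normal_variables.

(** * Processes with the same trigonometric expectations *)

Section trigonometric_class.
Context (R : realType) (I : Type) (D : set I).
Implicit Types (f g : (I -> R) -> R) (w : I -> R).

(** The closure of the trigonometric functions of finitely many coordinates in D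
    under linear combinations and bounded pointwise limits of sequences. *)
Inductive trig_class : ((I -> R) -> R) -> Prop :=
| trig_class_cos (theta : R) k (i : 'I_k -> I) (a : 'I_k -> R) :
    (forall j, D (i j)) ->
    trig_class (fun w => cos (theta + \sum_(j < k) a j * w (i j)))
| trig_class_lin (c : R) f g : trig_class f -> trig_class g ->
    trig_class (fun w => c * f w + g w)
| trig_class_lim (f_ : nat -> (I -> R) -> R) f (M : R) :
    (forall n, trig_class (f_ n)) -> (forall n w, `|f_ n w| <= M) ->
    (forall w, f_ n w @[n --> \oo] --> f w) -> trig_class f.

Lemma trig_class_bounded f : trig_class f -> exists M : R, forall w, `|f w| <= M.
Proof.
elim=> {f} [theta k i a _|c f g _ [Mf hf] _ [Mg hg]|f_ f M _ _ hM ff].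
- by exists 1 => w; exact: cos_max.
- exists (`|c| * Mf + Mg) => w; rewrite (le_trans (ler_normD _ _))// normrM.
  by rewrite lerD// ler_wpM2l.
- exists M => w; have h : `|f_ n w| @[n --> \oo] --> `|f w| by exact: cvg_norm.
  rewrite -(cvg_lim _ h)//; apply: limr_le; first by apply/cvg_ex; exists `|f w|.
  by apply: nearW => n; exact: hM.
Qed.

Lemma trig_class_cst c : trig_class (fun=> c).
Proof.
have h0 : trig_class (fun=> 1).
  (* the cosine of the empty combination *)
  have := @trig_class_cos 0 0
    (fun j => match j with Ordinal _ h => False_rect I (notF h) end) (fun=> 0).
  rewrite (_ : (fun=> _) = (fun=> 1)); first by apply; case.
  by apply/funext => w; rewrite big_ord0 addr0 cos0.
have h1 := trig_class_lin (-1) h0 h0.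
have := trig_class_lin c h0 h1.
rewrite (_ : (fun=> _) = (fun=> c)) => //.
by apply/funext => w; rewrite mulr1 mulN1r addNr addr0.
Qed.

Lemma trig_classZ c f : trig_class f -> trig_class (fun w => c * f w).
Proof.
move=> Cf; have := trig_class_lin c Cf (trig_class_cst 0).
by under [X in trig_class X -> _]funext do rewrite addr0.
Qed.

Lemma trig_classD f g : trig_class f -> trig_class g -> trig_class (fun w => f w + g w).
Proof.
move=> Cf Cg; have := trig_class_lin 1 Cf Cg.
by under [X in trig_class X -> _]funext do rewrite mul1r.
Qed.

Lemma trig_classB f g : trig_class f -> trig_class g -> trig_class (fun w => f w - g w).
Proof.
move=> Cf Cg; have := trig_class_lin (-1) Cg Cf.
by under [X in trig_class X -> _]funext do rewrite mulN1r addrC.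
Qed.

Let cosM (x y : R) : cos x * cos y = 2^-1 * (cos (x + y) + cos (x - y)).
Proof. by rewrite cosD cosB; field. Qed.

(** A product of two cosines is a sum of cosines, hence the class is an algebra. *)
Lemma trig_classM f g : trig_class f -> trig_class g -> trig_class (fun w => f w * g w).
Proof.
move=> Cf; elim: Cf g => {f} [theta k i a Di|c f1 f2 C1 IH1 C2 IH2|f_ f M C_ IH hM ff] g Cg.
- elim: Cg => {g} [theta' k' i' a' Di'|c f1 f2 C1 IH1 C2 IH2|f_ f M C_ IH hM ff].
  + pose i2 (j : 'I_(k + k')) := match fintype.split j with inl j => i j | inr j => i' j end.
    pose a2 (e : R) (j : 'I_(k + k')) :=
      match fintype.split j with inl j => a j | inr j => e * a' j end.
    have Di2 j : D (i2 j) by rewrite /i2; case: fintype.split.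
    have h e : trig_class (fun w => cos (theta + \sum_(j < k) a j * w (i j) +
        e * (theta' + \sum_(j < k') a' j * w (i' j)))).
      have := @trig_class_cos (theta + e * theta') _ i2 (a2 e) Di2.
      rewrite (_ : (fun w => _) = (fun w => cos (theta + \sum_(j < k) a j * w (i j) +
        e * (theta' + \sum_(j < k') a' j * w (i' j)))))//.
      apply/funext => w; congr cos; rewrite big_split_ord/=.
      rewrite mulrDr addrACA mulr_sumr; congr (_ + _ + (_ + _)); apply: eq_bigr => j _.
        by rewrite /a2 /i2 (unsplitK (inl _ j)).
      by rewrite /a2 /i2 (unsplitK (inr _ j)) mulrA.
    have := trig_classZ 2^-1 (trig_classD (h 1) (h (-1))).
    by under [X in trig_class X -> _]funext do rewrite mul1r mulN1r -cosM.
  + have := trig_class_lin c IH1 IH2.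
    by under [X in trig_class X -> _]funext do rewrite mulrCA -mulrDr.
  + apply: (@trig_class_lim _ _ M IH) => [n w|w].
      by rewrite normrM -[M]mul1r ler_pM// cos_max.
    by apply: cvgM; [exact: cvg_cst|exact: ff].
- have := trig_class_lin c (IH1 _ Cg) (IH2 _ Cg).
  by under [X in trig_class X -> _]funext do rewrite mulrA -mulrDl.
- have [Mg hg] := trig_class_bounded Cg.
  apply: (@trig_class_lim (fun n w => f_ n w * g w) _ (M * Mg)) => [n|n w|w].
  + exact: IH.
  + by rewrite normrM ler_pM.
  + by apply: cvgM; [exact: ff|exact: cvg_cst].
Qed.

(** The polynomial (3 y - y ^ 3) / 2. On [-1, 1] its iterates converge pointwise to
    the sign function, including at 0. *)
Let step (y : R) : R := 2^-1 * (3 * y - y * (y * y)).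

Let step_sg (y : R) : `|y| <= 1 ->
  (forall n, `|iter n step y| <= 1) /\ iter n step y @[n --> \oo] --> Num.sg y.
Proof.
have pos z : 0 < z <= 1 -> 0 < step z <= 1.
  move=> /andP[z0 z1]; apply/andP; split; rewrite /step; last first.
    have : 0 <= (1 - z) ^+ 2 * (z + 2) by rewrite mulr_ge0 ?sqr_ge0// addr_ge0// ltW.
    by rewrite (_ : _ * _ = 2 - 3 * z + z * (z * z)); [lra|ring].
  have : 0 < z * (3 - z * z) by apply: mulr_gt0 => //; nra.
  by lra.
have main z : 0 < z <= 1 -> (forall n, 0 < iter n step z <= 1) /\
    iter n step z @[n --> \oo] --> (1 : R).
  move=> z01.
  have h n : 0 < iter n step z <= 1 by elim: n => [//|n IH]; exact: pos.
  split=> //.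
  have nd : nondecreasing_seq (fun n => iter n step z).
    apply/nondecreasing_seqP => n /=; have /andP[] := h n.
    set x := iter n step z => x0 x1.
    have : 0 <= x * (1 - x * x) by apply: mulr_ge0; [exact: ltW|nra].
    by rewrite /step; lra.
  have cv : cvgn (fun n => iter n step z).
    by apply: nondecreasing_is_cvgn => //; exists 1 => _ [n _ <-]; case/andP: (h n).
  set l := limn (fun n => iter n step z).
  have cl : iter n step z @[n --> \oo] --> l by exact: cv.
  have zl : z <= l by apply: (nondecreasing_cvgn_le nd cv 0).
  have cs : iter n.+1 step z @[n --> \oo] --> step l.
    rewrite /=; apply: cvgM; first exact: cvg_cst.
    apply: cvgB; first by apply: cvgM => //; exact: cvg_cst.
    by do 2 apply: cvgM => //.
  have cs' : iter n.+1 step z @[n --> \oo] --> l.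
    by rewrite (cvg_shiftS (fun n => iter n step z)).
  have ll : step l = l.
    by apply: cvg_unique cs cs'.
  have l0 : 0 < l by rewrite (lt_le_trans _ zl)//; case/andP: z01.
  have : l * (1 - l) * (1 + l) = 0 by move: ll; rewrite /step; lra.
  have l10 : 1 + l != 0 by rewrite gt_eqF// addr_gt0.
  move=> /eqP; rewrite !mulf_eq0 (gt_eqF l0) (negbTE l10) orbF/= subr_eq0.
  by move=> /eqP ->.
have odd z n : iter n step (- z) = - iter n step z.
  by elim: n => [//|n IH] /=; rewrite IH /step; ring.
move=> y1; have [y0|y0|y0] := ltgtP y 0.
- have [|b c] := main (- y).
    by rewrite oppr_gt0 y0/= -(ltr0_norm y0).
  split=> [n|].
    by have := b n; rewrite odd => /andP[b0 b1]; rewrite -normrN ger0_norm// ltW.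
  rewrite ltr0_sg// -[X in X @ _]opprK; apply: cvgN.
  by move: c; under eq_fun do rewrite odd.
- have [|b c] := main y; first by rewrite y0 (le_trans (ler_norm _)).
  split=> [n|]; last by rewrite gtr0_sg.
  by have /andP[b0 b1] := b n; rewrite ger0_norm// ltW.
- rewrite y0 sgr0.
  have e n : iter n step 0 = 0.
    by elim: n => [//|n IH] /=; rewrite IH /step; ring.
  split=> [n|]; first by rewrite e normr0.
  by under eq_fun do rewrite e; exact: cvg_cst.
Qed.

Lemma trig_class_sg f : trig_class f -> (forall w, `|f w| <= 1) ->
  trig_class (fun w => Num.sg (f w)).
Proof.
move=> Cf f1; apply: (@trig_class_lim (fun n w => iter n step (f w)) _ 1) => [n|n w|w].
- elim: n => [//|n IH] /=; rewrite /step; apply: trig_classZ; apply: trig_classB.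
    exact: trig_classZ.
  by do 2 apply: trig_classM => //.
- by have [h _] := step_sg (f1 w); exact: h.
- by have [_] := step_sg (f1 w).
Qed.

(** The sign of w i - x is the limit, as n tends to infinity, of the sign of
    sin ((w i - x) / (n + 1)): the argument eventually lies in ]-pi, pi[. *)
Lemma trig_class_sg_eval i (x : R) : D i ->
  trig_class (fun w => Num.sg (w i - x)).
Proof.
move=> Di; pose y n (w : I -> R) : R := (w i - x) / n.+1%:R.
apply: (@trig_class_lim (fun n w => Num.sg (sin (y n w))) _ 1) => [n|n w|w].
- apply: (@trig_class_sg (fun w => sin (y n w))); last first.
    by move=> w; rewrite -cosBpihalf cos_max.
  have := @trig_class_cos (- x / n.+1%:R - pi / 2) 1 (fun=> i) (fun=> n.+1%:R^-1) (fun=> Di).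
  rewrite (_ : (fun w => _) = (fun w => sin (y n w)))//; apply/funext => w.
  by rewrite big_ord1 -cosBpihalf /y; congr cos; ring.
- by rewrite normr_sg; case: (_ != 0).
- have sg_sin (z : R) : `|z| < pi -> Num.sg (sin z) = Num.sg z.
    move=> zpi; have [z0|z0|->] := ltgtP z 0; last by rewrite sin0.
      rewrite (ltr0_sg z0) ltr0_sg// -oppr_gt0 -sinN sin_gt0_pi//.
      by rewrite oppr_gt0 z0/= -(ltr0_norm z0).
    by rewrite (gtr0_sg z0) gtr0_sg// sin_gt0_pi// z0/= -(gtr0_norm z0).
  apply: (cvg_near_cst (Num.sg (w i - x))); near=> n.
  rewrite sg_sin /y.
    by rewrite sgrM (gtr0_sg (x := n.+1%:R^-1)) ?invr_gt0// mulr1.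
  rewrite normrM normfV (@ger0_norm _ n.+1%:R)// ltr_pdivrMr//.
  rewrite mulrC -ltr_pdivrMr ?pi_gt0//.
  near: n; exists (Num.truncn (`|w i - x| / pi)) => // m /= hm.
  rewrite (lt_le_trans (truncnS_gt _))// ler_nat ltnS//.
Unshelve. all: by end_near. Qed.

(** The sets whose indicator belongs to the class form a sigma-algebra, because
    the class is an algebra that contains the constants. *)
Lemma sigma_algebra_trig_class (T : Type) (X : (I -> R) -> T) :
  sigma_algebra setT [set A : set T | trig_class (fun w => \1_A (X w))].
Proof.
split=> [|A /= CA|A /= CA].
- rewrite /= (_ : (fun w => _) = fun=> 0); first exact: trig_class_cst.
  by apply/funext => w; rewrite indic0.
- rewrite (_ : (fun w => _) = fun w => 1 - \1_A (X w)).
    by apply: trig_classB => //; exact: trig_class_cst.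
  by apply/funext => w; rewrite setTD !indicE in_setC; case: (_ \in _); rewrite /= ?subrr ?subr0.
- pose B n := \bigcup_(k < n) A k.
  have CB n : trig_class (fun w => \1_(B n) (X w)).
    elim: n => [|n IH].
      rewrite (_ : (fun w => _) = fun=> 0); first exact: trig_class_cst.
      by apply/funext => w; rewrite /B bigcup_mkord big_ord0 indic0.
    rewrite (_ : (fun w => _) = fun w =>
      1 - (1 - \1_(B n) (X w)) * (1 - \1_(A n) (X w))).
      apply: trig_classB; first exact: trig_class_cst.
      by apply: trig_classM; apply: trig_classB => //; exact: trig_class_cst.
    apply/funext => w.
    have -> : B n.+1 = B n `|` A n by rewrite /B !bigcup_mkord big_ord_recr.
    by rewrite !indicE in_setU; case: (_ \in _); case: (_ \in _) => /=; ring.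
  apply: (@trig_class_lim (fun n w => \1_(B n) (X w)) _ 1 CB) => [n w|w].
    by rewrite indicE; case: (_ \in _); rewrite ?normr1 ?normr0.
  rewrite indicE; have [Aw|Aw] := pselect ((\bigcup_k A k) (X w)).
    rewrite mem_set//; have [m _ Am] := Aw.
    apply: cvg_near_cst; exists m.+1 => // n /= mn; rewrite indicE mem_set//.
    by exists m.
  rewrite memNset//; apply: cvg_near_cst; apply: nearW => n.
  by rewrite indicE memNset// => -[m _ Am]; apply: Aw; exists m.
Qed.

Lemma trig_class_cylinder (E : set (I -> R)) : cylinder D E ->
  trig_class (fun w => \1_E w).
Proof.
move: E; apply: smallest_sub; first exact: (sigma_algebra_trig_class id).
move=> _ [i Di [B mB ->]] /=.
have h := sigma_algebra_trig_class (fun w => w i).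
have {h} : [set A : set R | trig_class (fun w => \1_A (w i))] B.
  have {mB} : (@ocitv R).-sigma.-measurable B by exact: mB.
  rewrite RGenOInfty.measurableE.
  move: B; apply: (smallest_sub h) => _ [x ->] /=.
  have h1 := trig_class_sg_eval x Di.
  suff -> : (fun w => \1_`]x, +oo[%classic (w i) : R) =
      fun w => 2^-1 * (Num.sg (w i - x) * Num.sg (w i - x) + Num.sg (w i - x)).
    exact: trig_classZ (trig_classD (trig_classM h1 h1) h1).
  apply/funext => w; rewrite indicE.
  have [wx|wx|->] := ltgtP (w i) x.
  - rewrite memNset/=; last by rewrite in_itv/= andbT ltNge ltW.
    by rewrite ltr0_sg ?subr_lt0// mulrNN mulr1 subrr mulr0.
  - rewrite mem_set/=; last by rewrite in_itv/= andbT.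
    by rewrite gtr0_sg ?subr_gt0// mulr1; field.
  - rewrite memNset/=; last by rewrite in_itv/= ltxx.
    by rewrite subrr sgr0 mulr0 addr0 mulr0.
by [].
Qed.

End trigonometric_class.

Lemma eq_integral_trig_class (R : realType) (d : measure_display)
    (T : measurableType d) (P : probability T R) (I : Type) (D : set I)
    (X Y : I -> T -> R) :
  (forall i, D i -> measurable_fun [set: T] (X i)) ->
  (forall i, D i -> measurable_fun [set: T] (Y i)) ->
  (forall (theta : R) k (i : 'I_k -> I) (a : 'I_k -> R), (forall j, D (i j)) ->
    (\int[P]_t (cos (theta + \sum_(j < k) a j * X (i j) t)%R)%:E =
     \int[P]_t (cos (theta + \sum_(j < k) a j * Y (i j) t)%R)%:E)%E) ->
  forall f, trig_class D f ->
    [/\ measurable_fun [set: T] (fun t => f (X^~ t)),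
        measurable_fun [set: T] (fun t => f (Y^~ t)) &
        (\int[P]_t (f (X^~ t))%:E = \int[P]_t (f (Y^~ t))%:E)%E].
Proof.
move=> mX mY XY f.
have mcos Z : (forall i, D i -> measurable_fun [set: T] (Z i)) ->
    forall (theta : R) k (i : 'I_k -> I) (a : 'I_k -> R), (forall j, D (i j)) ->
    measurable_fun [set: T] (fun t => cos (theta + \sum_(j < k) a j * Z (i j) t)).
  move=> mZ theta k i a Di.
  apply: (measurableT_comp (f := @cos R)).
    exact: (continuous_measurable_fun (@continuous_cos R)).
  apply: measurable_funD => //; apply: measurable_sum => j.
  by apply: measurable_funM => //; exact: mZ.
have iB Z f' : trig_class D f' -> measurable_fun [set: T] (fun t => f' (Z^~ t)) ->
    P.-integrable [set: T] (fun t => (f' (Z^~ t))%:E).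
  move=> Cf' mf'; have [M hM] := trig_class_bounded Cf'.
  apply: (@le_integrable _ _ _ _ _ _ _ (cst M%:E)) => //.
  - exact/measurable_EFinP.
  - by move=> t _ /=; rewrite lee_fin (le_trans (hM _))// ler_norm.
  - exact: finite_measure_integrable_cst.
elim=> {f} [theta k i a Di|c f g Cf [mf1 mf2 IHf] Cg [mg1 mg2 IHg]|f_ f M C_ IH hM ff].
- by split; [exact: mcos|exact: mcos|exact: XY].
- split.
  + by apply: measurable_funD => //; exact: measurable_funM.
  + by apply: measurable_funD => //; exact: measurable_funM.
  + under eq_integral do rewrite EFinD EFinM.
    under [RHS]eq_integral do rewrite EFinD EFinM.
    rewrite !integralD//=; last 4 first.
    * by apply: integrableZl => //; exact: iB.
    * exact: iB.
    * by apply: integrableZl => //; exact: iB.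
    * exact: iB.
    by rewrite !integralZl//; [rewrite IHf IHg|exact: iB|exact: iB].
have mlim (Z : I -> T -> R) : (forall n, measurable_fun [set: T] (fun t => f_ n (Z^~ t))) ->
    measurable_fun [set: T] (fun t => f (Z^~ t)).
  by move=> mZ; apply: (measurable_fun_cvg mZ) => t _; exact: ff.
have clim (Z : I -> T -> R) : (forall n, measurable_fun [set: T] (fun t => f_ n (Z^~ t))) ->
    (\int[P]_t (f_ n (Z^~ t))%:E @[n --> \oo] --> \int[P]_t (f (Z^~ t))%:E)%E.
  move=> mZ.
  have [] := @dominated_convergence _ T R P setT measurableT
    (fun n t => (f_ n (Z^~ t))%:E) (fun t => (f (Z^~ t))%:E) (cst M%:E).
  - by move=> n; exact/measurable_EFinP.
  - by apply/measurable_EFinP; exact: mlim.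
  - by apply: aeW => t _; apply: cvg_EFin; [exact: nearW|exact: ff].
  - exact: finite_measure_integrable_cst.
  - by apply: aeW => t n _ /=; rewrite lee_fin.
  - by [].
have m1 n : measurable_fun [set: T] (fun t => f_ n (X^~ t)) by case: (IH n).
have m2 n : measurable_fun [set: T] (fun t => f_ n (Y^~ t)) by case: (IH n).
split; [exact: mlim|exact: mlim|].
have h1 := clim _ m1; have := clim _ m2.
under eq_fun => n do (have [_ _ <-] := IH n).
by move=> h2; exact: (cvg_unique _ h1 h2).
Qed.

(** A process version of the uniqueness theorem for characteristic functions: two
    processes on the same probability space whose finite linear combinations have
    the same trigonometric expectations have the same law on cylinder sets. *)
Lemma eq_law_of_cos (R : realType) (d : measure_display)
    (T : measurableType d) (P : probability T R) (I : Type) (D : set I)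
    (X Y : I -> T -> R) :
  (forall i, D i -> measurable_fun [set: T] (X i)) ->
  (forall i, D i -> measurable_fun [set: T] (Y i)) ->
  (forall (theta : R) k (i : 'I_k -> I) (a : 'I_k -> R), (forall j, D (i j)) ->
    (\int[P]_t (cos (theta + \sum_(j < k) a j * X (i j) t)%R)%:E =
     \int[P]_t (cos (theta + \sum_(j < k) a j * Y (i j) t)%R)%:E)%E) ->
  forall E : set (I -> R), cylinder D E ->
    [/\ measurable [set t | E (X^~ t)], measurable [set t | E (Y^~ t)] &
        P [set t | E (X^~ t)] = P [set t | E (Y^~ t)]].
Proof.
move=> mX mY XY E cE.
have [m1 m2] := eq_integral_trig_class mX mY XY (trig_class_cylinder cE).
have mE Z : measurable_fun [set: T] (fun t : T => \1_E (Z t) : R) ->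
    measurable [set t | E (Z t)].
  move=> mZ; have := mZ measurableT _ (measurable_set1 1).
  rewrite setTI (_ : _ @^-1` _ = [set t | E (Z t)])//.
  apply/seteqP; split=> t /=; rewrite indicE.
    by case: (boolP (Z t \in E)) => [/set_mem//|_ /eqP]; rewrite eq_sym oner_eq0.
  by move=> Et; rewrite mem_set.
move: (mE _ m1) (mE _ m2) => m1' m2'.
have iE Z : measurable [set t | E (Z t)] ->
    (\int[P]_t (\1_E (Z t) : R)%:E = P [set t | E (Z t)])%E.
  move=> mZ; have := integral_indic P measurableT mZ; rewrite setIT => <-.
  apply: eq_integral => t _; rewrite !indicE.
  by have [Et|Et] := pselect (E (Z t)); [rewrite !mem_set|rewrite !memNset].
by rewrite !iE.
Qed.

(** * Invariance of the white noise under resampling *)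

Section cubes_and_boxes.
Context (R : realType) (d : nat).
Implicit Types (v w : lattice d) (x : d.-tuple R).

Lemma translateE v (A : set (d.-tuple R)) :
  translate v A = [set x | A [tuple tnth x i - (v i)%:~R | i < d]].
Proof.
apply/seteqP; split=> x /=.
  move=> [y Ay <-]; rewrite (_ : [tuple _ | _ < _] = y)//.
  by apply: eq_from_tnth => i; rewrite !tnth_mktuple addrK.
move=> Ax; exists [tuple tnth x i - (v i)%:~R | i < d] => //.
by apply: eq_from_tnth => i; rewrite !tnth_mktuple subrK.
Qed.

Lemma unit_cubeE v :
  unit_cube (R:=R) v = [set x | forall i, (v i)%:~R <= tnth x i <= (v i)%:~R + 1].
Proof.
rewrite /unit_cube translateE; apply/seteqP; split=> x /= h i; have := h i;
  by rewrite tnth_mktuple subr_ge0 lerBlDl.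
Qed.

Lemma boxE v n : box (R:=R) v n =
  [set x | forall i, (v i)%:~R - n%:R <= tnth x i <= (v i)%:~R + n%:R].
Proof.
rewrite /box translateE; apply/seteqP; split=> x /= h i; move: (h i);
  rewrite tnth_mktuple => /andP[h1 h2]; apply/andP; split; lra.
Qed.

Lemma box0E n : box (R:=R) (0 : lattice d) n = Lambda n.
Proof.
rewrite boxE; apply/seteqP; split=> x /= h i; have := h i;
  by rewrite ffunE sub0r add0r.
Qed.

Lemma measurable_unit_cube v : measurable (unit_cube (R:=R) v).
Proof.
rewrite unit_cubeE (_ : [set _ | _] =
  \bigcap_(i in [set: 'I_d]) ((@tnth d R ^~ i) @^-1` `[(v i)%:~R, (v i)%:~R + 1])).
  apply: fin_bigcap_measurable => // i _.
  by rewrite -[X in measurable X]setTI; apply: measurable_tnth.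
apply/seteqP; split => x /= h i; first by move=> _; rewrite /= in_itv/=; exact: h.
by have := h i Logic.I; rewrite /= in_itv/=.
Qed.

Lemma finite_borelI (A B : set (d.-tuple R)) : finite_borel A -> measurable B ->
  finite_borel (A `&` B).
Proof.
move=> [mA lA] mB; split; first exact: measurableI.
by apply: le_lt_trans lA; apply: le_measure; rewrite ?inE//; exact: measurableI.
Qed.

Lemma finite_borelD (A B : set (d.-tuple R)) : finite_borel A -> measurable B ->
  finite_borel (A `\` B).
Proof. by move=> fA mB; rewrite setDE; apply: finite_borelI => //; exact: measurableC. Qed.

Lemma L2_indic (A : set (d.-tuple R)) : finite_borel A -> L2 (\1_A).
Proof.
move=> [mA lA]; rewrite /L2/= inE; apply/andP; split; rewrite inE/=.
  exact: measurable_indic.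
rewrite /finite_norm unlock/=.
apply: poweR_lty; apply: le_lt_trans lA.
have -> : lebesgue R d A = (\int[lebesgue R d]_x (\1_A x)%:E)%E.
  by rewrite integral_indic// setIT.
apply: ge0_le_integral => //.
- apply/measurable_EFinP; apply: (@measurableT_comp _ _ _ _ _ _ (fun x : R => x `^ 2)) => //.
  by apply: measurableT_comp => //; exact: measurable_indic.
- by apply/measurable_EFinP; exact: measurable_indic.
- move=> x _; rewrite lee_fin indicE; case: (_ \in _).
    by rewrite normr1 powR1.
  by rewrite normr0 powR0.
Qed.

End cubes_and_boxes.

(** Events on a finite linear combination of coordinates are cylinder events. *)
Lemma cylinder_lin (R : realType) (I : Type) (D : set I) k (i : 'I_k -> I)
    (a : 'I_k -> R) (B : set R) : (forall j, D (i j)) -> measurable B ->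
  cylinder D [set w : I -> R | B (\sum_(j < k) a j * w (i j))].
Proof.
move=> Di mB.
pose G := [set E : set (I -> R) | exists2 i, D i &
        exists2 B : set R, measurable B & E = [set w | B (w i)]].
have mev j : measurable_fun [set: g_sigma_algebraType G]
    (fun w : g_sigma_algebraType G => (w : I -> R) (i j)).
  move=> _ C mC; rewrite setTI; apply: sub_sigma_algebra.
  by exists (i j) => //; exists C.
have ms : measurable_fun [set: g_sigma_algebraType G]
    (fun w : g_sigma_algebraType G => \sum_(j < k) a j * (w : I -> R) (i j)).
  by apply: measurable_sum => j; apply: measurable_funM => //; exact: mev.
by have := ms measurableT B mB; rewrite setTI.
Qed.

Section white_noise_law.
Context (R : realType) (d : nat) (disp : measure_display)
  (T : measurableType disp) (P : probability T R)
  (W W' : (d.-tuple R -> R) -> T -> R).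
Hypothesis hW : white_noise P W.

Lemma measurable_white_noise h : L2 h -> measurable_fun [set: T] (W h).
Proof.
move=> Lh; have [gp _ _] := hW.
have [] := gp 1%N (fun=> h) (fun=> 1) (fun=> Lh).
by under eq_fun do rewrite big_ord1 mul1r.
Qed.

Lemma white_noise_covariance g h : L2 g -> L2 h ->
  (\int[lebesgue R d]_x (g x * h x)%:E)%E \is a fin_num.
Proof.
move=> Lg Lh.
have /Lfun1_integrable := Lfun2_mul_Lfun1 Lg Lh.
exact: integrable_fin_num.
Qed.

Lemma Lfun2_white_noise h : L2 h -> W h \in Lfun P 2%:E.
Proof.
move=> Lh; have [_ _ cov] := hW.
have mWh := measurable_white_noise Lh.
rewrite inE; apply/andP; split; rewrite inE//=.
rewrite /finite_norm unlock/=; apply: poweR_lty.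
have := white_noise_covariance Lh Lh; rewrite -cov// unlock fin_numElt => /andP[_].
apply: le_lt_trans; rewrite le_eqVlt; apply/orP; left; apply/eqP.
by apply: eq_integral => t _; rewrite powR_mulrn// expr2 -normrM ger0_norm// -expr2 sqr_ge0.
Qed.

Lemma Lfun1_white_noise h : L2 h -> W h \in Lfun P 1.
Proof.
move=> Lh; apply: Lfun_subset12; last exact: Lfun2_white_noise.
exact: fin_num_measure.
Qed.

Section linear_combination.
Variables (k : nat) (h : 'I_k -> d.-tuple R -> R) (a : 'I_k -> R).
Hypothesis Lh : forall j, L2 (h j).

(** The variance of the linear combination of the W (h j) with coefficients a j. *)
Definition white_noise_variance : R :=
  \sum_(j < k) \sum_(l < k)
    a j * a l * fine (\int[lebesgue R d]_x (h j x * h l x)%:E)%E.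

Lemma white_noise_lin_moments (V := fun t => \sum_(j < k) a j * W (h j) t) :
  [/\ gaussian P V, ('E_P[V] = 0)%E &
      ('E_P[fun t => (V t * V t)%R] = white_noise_variance%:E)%E].
Proof.
have [gp m0 cov] := hW.
have i1 j : P.-integrable [set: T] (EFin \o W (h j)).
  by apply/Lfun1_integrable; exact: Lfun1_white_noise.
have i2 j l : P.-integrable [set: T] (EFin \o (W (h j) \* W (h l))).
  by apply/Lfun1_integrable; apply: Lfun2_mul_Lfun1; exact: Lfun2_white_noise.
split; first exact: gp.
- rewrite unlock /V.
  under eq_integral do rewrite -sumEFin.
  rewrite integral_sum//=; last first.
    move=> j; under eq_fun do rewrite EFinM.
    by apply: integrableZl => //; exact: i1.
  apply: big1 => j _; under eq_integral do rewrite EFinM.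
  rewrite integralZl//; last exact: i1.
  by have := m0 _ (Lh j); rewrite unlock => ->; rewrite mule0.
- rewrite unlock /V /white_noise_variance.
  have VV t : ((\sum_(j < k) a j * W (h j) t) * (\sum_(j < k) a j * W (h j) t))%:E =
      (\sum_(j < k) \sum_(l < k) ((a j * a l)%:E * (W (h j) t * W (h l) t)%:E))%E.
    rewrite big_distrlr/= -sumEFin; apply: eq_bigr => j _.
    by rewrite -sumEFin; apply: eq_bigr => l _; rewrite -EFinM mulrACA.
  under eq_integral do rewrite VV.
  have i3 j l : P.-integrable [set: T] (fun t => (a j * a l)%:E * (W (h j) t * W (h l) t)%:E)%E.
    by apply: integrableZl => //; exact: i2.
  rewrite integral_sum//=; last first.
    by move=> j; apply: integrable_sum => // l _; exact: i3.
  rewrite -sumEFin; apply: eq_bigr => j _.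
  rewrite integral_sum//= -sumEFin; apply: eq_bigr => l _.
  rewrite integralZl//; last exact: i2.
  have := cov _ _ (Lh j) (Lh l); rewrite unlock => ->.
  by rewrite [in RHS]EFinM fineK// white_noise_covariance.
Qed.

End linear_combination.

Lemma white_noise_variance_indic k (A : 'I_k -> set (d.-tuple R)) (a : 'I_k -> R) :
  (forall j, measurable (A j)) ->
  white_noise_variance (fun j => \1_(A j)) a =
  \sum_(j < k) \sum_(l < k) a j * a l * fine (lebesgue R d (A j `&` A l)).
Proof.
move=> mA; apply: eq_bigr => j _; apply: eq_bigr => l _; congr (_ * fine _).
rewrite -[X in _ = lebesgue R d X]setIT -integral_indic//; last exact: measurableI.
by apply: eq_integral => x _; rewrite indicI.
Qed.

Hypothesis hW' : independent_copy P (@L2 R d) W W'.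

(** A linear combination of the independent copy has the law of the same linear
    combination of the original noise. *)
Lemma copy_lin k (h : 'I_k -> d.-tuple R -> R) (a : 'I_k -> R) s :
  (forall j, L2 (h j)) ->
  centred_normal P (fun t => \sum_(j < k) a j * W (h j) t) s ->
  centred_normal P (fun t => \sum_(j < k) a j * W' (h j) t) s.
Proof.
move=> Lh [mV hV]; have [mW' law _] := hW'.
have mV' : measurable_fun [set: T] (fun t => \sum_(j < k) a j * W' (h j) t).
  by apply: measurable_sum => j; apply: measurable_funM => //; exact: mW'.
have lawE B : measurable B -> P ((fun t => \sum_(j < k) a j * W' (h j) t) @^-1` B) =
    P ((fun t => \sum_(j < k) a j * W (h j) t) @^-1` B).
  by move=> mB; have := law _ (cylinder_lin a Lh mB).
split=> //; case: hV => [[s0 V0]|[s0 VE]]; [left|right].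
- split=> //.
  have m0 : measurable (~` [set (0 : R)]) by apply: measurableC.
  exists ((fun t => \sum_(j < k) a j * W' (h j) t) @^-1` (~` [set 0])); split => //.
  + by rewrite -[X in measurable X]setTI; exact: mV'.
  + rewrite lawE//; have [N [mN N0 sN]] := V0.
    by apply: subset_measure0 N0 => //; rewrite -[X in measurable X]setTI; exact: mV.
- by split=> // B mB; rewrite lawE// VE.
Qed.

(** Resampling the noise in a unit cube B does not change its law. A linear
    combination of the W (A j) is Gaussian, and its variance is the sum of those of
    the same combinations of the W (A j \ B) and of the W (A j & B). The resampled
    combination is the sum of the former and of an independent copy of the latter,
    hence it has the same law, and [eq_law_of_cos] applies. *)
Lemma resample_law v (E : set (noise R d)) : cylinder (@finite_borel R d) E ->
  [/\ measurable [set t | E (set_noise W t)],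
      measurable [set t | E (resample v (set_noise W t) (set_noise W' t))] &
      P [set t | E (set_noise W t)] =
      P [set t | E (resample v (set_noise W t) (set_noise W' t))]].
Proof.
move=> cE; have [mW' _ indep] := hW'.
pose B : set (d.-tuple R) := unit_cube (R:=R) v.
have mB : measurable B by exact: measurable_unit_cube.
pose X (A : set (d.-tuple R)) t := W (\1_A) t.
pose Y (A : set (d.-tuple R)) t := W (\1_(A `\` B)) t + W' (\1_(A `&` B)) t.
apply: (@eq_law_of_cos R disp T P _ (@finite_borel R d) X Y _ _ _ E cE) => [A fA|A fA|].
- by apply: measurable_white_noise; exact: L2_indic.
- apply: measurable_funD.
    by apply: measurable_white_noise; apply: L2_indic; exact: finite_borelD.
  by apply: mW'; apply: L2_indic; exact: finite_borelI.
move=> theta k A a fA.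
have [kap [kap0 normal_of]] := gaussian_centred_normal P.
have mA j : measurable (A j) by case: (fA j).
have L0 j : L2 (\1_(A j)) by exact: L2_indic.
have L1 j : L2 (\1_(A j `\` B)) by apply: L2_indic; exact: finite_borelD.
have LI j : L2 (\1_(A j `&` B)) by apply: L2_indic; exact: finite_borelI.
have [g0 m0 v0] := white_noise_lin_moments a L0.
have [g1 m1 v1] := white_noise_lin_moments a L1.
have [g2 m2 v2] := white_noise_lin_moments a LI.
have n0 := normal_of _ _ g0 m0 v0.
have n1 := normal_of _ _ g1 m1 v1.
have n2 := copy_lin LI (normal_of _ _ g2 m2 v2).
have pos (V : T -> R) u : ('E_P[fun t => (V t * V t)%R] = u%:E)%E -> 0 <= u.
  move=> e; rewrite -lee_fin -e unlock; apply: integral_ge0 => t _.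
  by rewrite lee_fin -expr2 sqr_ge0.
have var : white_noise_variance (fun j => \1_(A j)) a =
    white_noise_variance (fun j => \1_(A j `\` B)) a +
    white_noise_variance (fun j => \1_(A j `&` B)) a.
  rewrite !white_noise_variance_indic//; last 2 first.
  - by move=> j; exact: measurableI.
  - by move=> j; exact: measurableD.
  rewrite -big_split; apply: eq_bigr => j _.
  rewrite -big_split/=; apply: eq_bigr => l _; rewrite -mulrDr; congr (_ * _).
  have f0 : finite_borel (A j `&` A l) by exact: finite_borelI.
  have [mAA _] := f0.
  have [_ f1] := finite_borelD f0 mB; have [_ f2] := finite_borelI f0 mB.
  rewrite -fineD; last 2 first.
  - by rewrite ge0_fin_numE// (_ : _ `&` _ = (A j `&` A l) `\` B)// !setDE setIACA setIid.
  - by rewrite ge0_fin_numE// (_ : _ `&` _ = (A j `&` A l) `&` B)// setIACA setIid.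
  congr fine; rewrite (_ : (A j `\` B) `&` _ = (A j `&` A l) `\` B); last first.
    by rewrite !setDE setIACA setIid.
  by rewrite (_ : (A j `&` B) `&` _ = (A j `&` A l) `&` B) -?measureDI// setIACA setIid.
(* 1 is added to make the integrand nonnegative *)
pose G (x : R) := 1 + cos (theta + x).
have cG : continuous G.
  move=> x; apply: cvgD; first exact: cvg_cst.
  apply: (cvg_comp _ (@cos R)); last exact: continuous_cos.
  by apply: cvgD; [exact: cvg_cst|exact: cvg_id].
have G0 x : 0 <= G x.
  by rewrite /G -lerBlDl sub0r; have := cos_max (theta + x); rewrite ler_norml => /andP[].
have mcos (V : T -> R) : measurable_fun [set: T] V ->
    P.-integrable [set: T] (fun t => (cos (theta + V t))%:E).
  move=> mV; apply: (@le_integrable _ _ _ _ _ _ _ (cst 1%:E)) => //.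
  - apply/measurable_EFinP; apply: (measurableT_comp (f := @cos R)).
      exact: (continuous_measurable_fun (@continuous_cos R)).
    exact: measurable_funD.
  - by move=> t _ /=; rewrite lee_fin normr1 cos_max.
  - exact: finite_measure_integrable_cst.
have GE (V : T -> R) : measurable_fun [set: T] V ->
    (\int[P]_t (G (V t))%:E = 1%:E + \int[P]_t (cos (theta + V t))%:E)%E.
  move=> mV; under eq_integral do rewrite EFinD.
  rewrite integralD//=; last 2 first.
  - exact: finite_measure_integrable_cst.
  - exact: mcos.
  by rewrite integral_cst//= probability_setT mule1.
pose S t := \sum_(j < k) a j * W (\1_(A j `\` B)) t.
pose S' t := \sum_(j < k) a j * W' (\1_(A j `&` B)) t.
have YE t : \sum_(j < k) a j * Y (A j) t = S t + S' t.
  by rewrite /Y /S /S' -big_split/=; apply: eq_bigr => j _; rewrite mulrDr.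
under [RHS]eq_integral do rewrite YE.
have add1I (x y : \bar R) : (1%:E + x = 1%:E + y)%E -> x = y.
  by move=> /(congr1 (fun z => z - 1%:E)%E); rewrite ![(1%:E + _)%E]addeC !addeK.
apply: add1I.
rewrite -GE; last by case: n0.
rewrite -GE; last first.
  by apply: measurable_funD; [case: n1|case: n2].
rewrite (ge0_integral_centred_normal n0 cG G0).
rewrite (ge0_integral_centred_normalD n1 n2 _ cG G0); last first.
  move=> C C' mC mC'.
  exact: (indep _ _ (cylinder_lin a L1 mC) (cylinder_lin a LI mC')).
congr (normal_expectation _ (Num.sqrt _)).
by rewrite !sqr_sqrtr ?divr_ge0 ?(ltW kap0)// ?(pos _ _ v1) ?(pos _ _ v2)// var mulrDl.
Qed.

End white_noise_law.

(** * Lattice sums, boxes and cubes *)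

Section power_series.
Context (R : realType).

(** The terms of the series of 1 / k ^ (1 + a) are dominated by a telescoping
    series; this comes from 1 + a / y <= (y / x) ^ a for y = x + 1. *)
Lemma powRN_telescope (a : R) (k : nat) : 0 < a ->
  k.+2%:R `^ (- (1 + a)) <= a^-1 * (k.+1%:R `^ (- a) - k.+2%:R `^ (- a)).
Proof.
move=> a0; set x : R := k.+1%:R; set y : R := k.+2%:R.
have x0 : 0 < x by rewrite ltr0n.
have y0 : 0 < y by rewrite ltr0n.
have yx : y = x + 1 by rewrite /y /x -natr1.
have -> : y `^ (- (1 + a)) = y `^ (- a) / y.
  have -> : - (1 + a) = - a + - 1 by ring.
  by rewrite powRD ?(gt_eqF y0) ?implybT// powR_inv1// ltW.
have -> : x `^ (- a) = y `^ (- a) * (y / x) `^ a.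
  have xa : x `^ a != 0 by rewrite gt_eqF ?powR_gt0.
  have -> : (y / x) `^ a = y `^ a / x `^ a.
    by apply: (mulIf xa); rewrite divfK// -powRM ?divfK ?gt_eqF// ?divr_ge0// ltW.
  by rewrite !powRN mulrA mulVf ?mul1r// gt_eqF ?powR_gt0.
have h : 1 + a / y <= (y / x) `^ a.
  rewrite /powR gt_eqF ?divr_gt0//; apply: le_trans (expR_ge1Dx _).
  rewrite lerD2l ler_wpM2l ?(ltW a0)//.
  have : ln (x / y) <= x / y - 1.
    by rewrite -ler_expR lnK ?posrE ?divr_gt0// (le_trans _ (expR_ge1Dx _))// addrC subrK.
  rewrite -[x / y]invf_div lnV ?posrE ?divr_gt0// invf_div.
  rewrite lerNl; apply: le_trans; rewrite le_eqVlt; apply/orP; left; apply/eqP.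
  have -> : x = y - 1 by rewrite yx addrK.
  by field; rewrite gt_eqF.
have -> : y `^ (- a) * (y / x) `^ a - y `^ (- a) = y `^ (- a) * ((y / x) `^ a - 1) by ring.
rewrite mulrCA ler_wpM2l ?powR_ge0//; move: h; rewrite -lerBrDl => h.
by rewrite mulrC ler_pdivlMr// mulrC.
Qed.

Lemma sum_powRN_le (a : R) (n : nat) : 0 < a ->
  \sum_(k < n) k.+1%:R `^ (- (1 + a)) <= 1 + a^-1.
Proof.
move=> a0; case: n => [|n]; first by rewrite big_ord0 addr_ge0// invr_ge0 ltW.
rewrite big_ord_recl/= powR1 lerD2l.
apply: (@le_trans _ _ (a^-1 * (1 - n.+1%:R `^ (- a)))); last first.
  by rewrite ler_piMr ?invr_ge0 ?(ltW a0)// lerBlDr lerDl powR_ge0.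
elim: n => [|n IH]; first by rewrite big_ord0 powR1 subrr mulr0.
rewrite big_ord_recr/=; apply: le_trans (lerD IH (powRN_telescope n a0)) _.
by rewrite -mulrDr addrA subrK.
Qed.

Lemma sum_shift_powRN_le (a : R) (n : nat) : 0 < a ->
  \sum_(j < n + n.+1) (1 + `|(j%:Z - n%:Z)%:~R : R|) `^ (- (1 + a)) <=
  2 * (1 + a^-1).
Proof.
move=> a0; rewrite big_split_ord/= mulr_natl mulr2n; apply: lerD.
  rewrite (reindex_inj rev_ord_inj)/=.
  apply: le_trans (sum_powRN_le n.+1 a0).
  rewrite [leRHS]big_ord_recl -[leLHS]add0r; apply: lerD; first exact: powR_ge0.
  apply: ler_sum => j _; rewrite le_eqVlt; apply/orP; left; apply/eqP.
  congr (_ `^ _); have jn : (j < n)%N by [].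
  have -> : ((n - j.+1)%N%:Z - n%:Z) = - j.+1%:Z by lia.
  by rewrite mulrNz normrN ger0_norm// /bump/= -natr1 addrC.
apply: le_trans (sum_powRN_le n.+1 a0).
apply: ler_sum => j _; rewrite le_eqVlt; apply/orP; left; apply/eqP.
congr (_ `^ _).
have -> : ((n + j)%N%:Z - n%:Z) = j%:Z by lia.
by rewrite ger0_norm// -natr1 addrC.
Qed.

End power_series.

Section lattice_boxes.
Context (R : realType) (d : nat).
Implicit Types (u v w : lattice d).

(** The lattice points w such that u i <= w i < u i + m for all i, enumerated
    without repetition. *)
Definition lattice_box u (m : nat) : seq (lattice d) :=
  [seq [ffun i => u i + (f i)%:Z] | f : {ffun 'I_d -> 'I_m}].

Lemma mem_lattice_box u m w :
  (w \in lattice_box u m) = [forall i, (u i <= w i < u i + m%:Z)%R].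
Proof.
apply/mapP/forallP => [[f _ ->] i|h].
  rewrite ffunE; have := ltn_ord (f i); set x := nat_of_ord _; lia.
have lt i : (`|(w i - u i)%R| < m)%N by have := h i; lia.
exists [ffun i => Ordinal (lt i)]; first by rewrite mem_enum.
by apply/ffunP => i; rewrite !ffunE/=; have := h i; lia.
Qed.

Lemma uniq_lattice_box u m : uniq (lattice_box u m).
Proof.
rewrite map_inj_uniq ?enum_uniq// => f g /ffunP fg; apply/ffunP => i.
by have := fg i; rewrite !ffunE => /addrI [] /val_inj.
Qed.

Lemma size_lattice_box u m : size (lattice_box u m) = (m ^ d)%N.
Proof. by rewrite size_map -cardE card_ffun !card_ord. Qed.

Lemma sum_sub_le (I : eqType) (s s' : seq I) (f : I -> R) : uniq s -> uniq s' ->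
  {subset s <= s'} -> (forall x, 0 <= f x) ->
  \sum_(x <- s) f x <= \sum_(x <- s') f x.
Proof.
move=> us us' ss' f0.
have p : perm_eq s [seq x <- s' | x \in s].
  apply: uniq_perm => //; first exact: filter_uniq.
  by move=> x; rewrite mem_filter; case: (boolP (x \in s)) => // /ss' ->.
rewrite (perm_big _ p) big_filter big_mkcond; apply: ler_sum => x _; by case: ifP.
Qed.

Lemma abs_le_eucl v w i : `|(v i - w i)%:~R : R| <= eucl (embed R v) (embed R w).
Proof.
rewrite /eucl -sqrtr_sqr ler_sqrt; last first.
  by rewrite sumr_ge0// => j _; rewrite sqr_ge0.
rewrite (bigD1 i)//= !tnth_mktuple rmorphB/= lerDl sumr_ge0// => j _.
exact: sqr_ge0.
Qed.

(** The quantity 1 + |v - w| that governs the decay of the majorants. *)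
Definition lattice_gap v w : R := 1 + eucl (embed R v) (embed R w).

Lemma lattice_gap_gt0 v w : 0 < lattice_gap v w.
Proof. by rewrite ltr_pwDl// sqrtr_ge0. Qed.

Lemma lattice_gap_ge1 v w : 1 <= lattice_gap v w.
Proof. by rewrite lerDl sqrtr_ge0. Qed.

(** Sums of (1 + |v - w|) ^ - (d + eta) over finite sets of lattice points are
    bounded, uniformly in v and in the set. Since |w i - v i| <= |w - v|, the
    summand is at most the product of the d factors (1 + |w i - v i|) ^ - (1 + a)
    with a = eta / d, and a sum of products over a box is a product of sums. *)
Lemma lattice_sum_le (eta : R) : (0 < d)%N -> 0 < eta ->
  exists2 B : R, 0 <= B & forall v (s : seq (lattice d)), uniq s ->
    \sum_(w <- s) lattice_gap v w `^ (- (d%:R + eta)) <= B.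
Proof.
move=> d0 eta0; have dR : 0 < d%:R :> R by rewrite ltr0n.
pose a := eta / d%:R; have a0 : 0 < a by rewrite divr_gt0.
exists ((2 * (1 + a^-1)) ^+ d).
  by rewrite exprn_ge0// mulr_ge0// addr_ge0// invr_ge0 ltW.
move=> v s us.
pose g (z : int) : R := (1 + `|z%:~R|) `^ (- (1 + a)).
have le_prod w : lattice_gap v w `^ (- (d%:R + eta)) <= \prod_(i < d) g (w i - v i).
  have -> : - (d%:R + eta) = d%:R * - (1 + a).
    by rewrite /a; field; rewrite gt_eqF.
  rewrite powRrM powR_mulrn ?(ltW (lattice_gap_gt0 _ _))//.
  rewrite -[X in _ ^+ X](card_ord d) -prodr_const.
  have powR_prod (h : 'I_d -> R) : (forall i, 0 <= h i) ->
      (\prod_i h i) `^ (- (1 + a)) = \prod_i (h i) `^ (- (1 + a)).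
    move=> h0; elim: (index_enum _) => [|x r IH]; first by rewrite !big_nil powR1.
    by rewrite !big_cons powRM// ?IH// prodr_ge0.
  rewrite powR_prod; last by move=> i; exact: ltW (lattice_gap_gt0 _ _).
  apply: ler_prod => i _; rewrite powR_ge0/= /g !powRN.
  have p1 : 0 < 1 + `|(w i - v i)%:~R : R| by rewrite ltr_pwDl.
  rewrite lef_pV2 ?posrE ?powR_gt0 ?lattice_gap_gt0//.
  rewrite ge0_ler_powR ?nnegrE ?(ltW (lattice_gap_gt0 _ _))//.
  - by rewrite addr_ge0// ltW.
  - by rewrite lerD2l -normrN -rmorphN/= opprB abs_le_eucl.
pose N := \max_(w <- s) \max_(i < d) `|(w i - v i)%R|%N.
pose L := lattice_box [ffun i => v i - N%:Z] (N + N.+1).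
have sL (w : lattice d) : w \in s -> w \in L.
  move=> ws; rewrite mem_lattice_box; apply/forallP => i; rewrite ffunE.
  have : (`|(w i - v i)%R| <= N)%N.
    rewrite /N (big_rem w)//= leq_max; apply/orP; left.
    exact: (leq_bigmax (F := fun i => `|(w i - v i)%R|%N)).
  by lia.
apply: (le_trans (ler_sum _ (fun w _ => le_prod w))).
apply: (le_trans (sum_sub_le us (uniq_lattice_box _ _) sL _)).
  by move=> w; apply: prodr_ge0 => i _; exact: powR_ge0.
rewrite big_map big_enum/=.
have e (z : int) (j : nat) : z - N%:Z + j%:Z - z = j%:Z - N%:Z by lia.
under eq_bigr => f _ do under eq_bigr => i _ do rewrite !ffunE e.
rewrite -(bigA_distr_bigA (fun i (j : 'I_(N + N.+1)) => g (j%:Z - N%:Z))).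
apply: (@le_trans _ _ (\prod_(i < d) (2 * (1 + a^-1)))).
  apply: ler_prod => i _; rewrite sum_shift_powRN_le// andbT.
  by apply: sumr_ge0 => j _; exact: powR_ge0.
by rewrite prodr_const card_ord.
Qed.

(** A cube of half-side n contains (2 n + 1) ^ d lattice points. *)
Lemma mem_box_embed u n w :
  box u n (embed R w) <-> w \in lattice_box [ffun i => u i - n%:Z] (2 * n).+1.
Proof.
rewrite boxE mem_lattice_box; split => [h|/forallP h i].
  apply/forallP => i; have := h i; rewrite tnth_mktuple ffunE.
  rewrite -[n%:R]/(n%:Z%:~R) -rmorphB -rmorphD !ler_int; lia.
have := h i; rewrite tnth_mktuple ffunE.
rewrite -[n%:R]/(n%:Z%:~R) -rmorphB -rmorphD/= !ler_int; lia.
Qed.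

(** A cube of half-side n is the union of (2 n) ^ d unit cubes. *)
Lemma box_cubes u n : (0 < n)%N ->
  box (R:=R) u n = cubes (lattice_box [ffun i => u i - n%:Z] (2 * n)).
Proof.
move=> n0; rewrite boxE; apply/seteqP; split=> x /=.
  move=> h.
  pose w : lattice d := [ffun i => if tnth x i < (u i)%:~R + n%:R
    then Num.floor (tnth x i) else u i + n%:Z - 1].
  have iN (z : int) : z%:~R + n%:R = (z + n%:Z)%:~R :> R by rewrite rmorphD.
  have iB (z : int) : z%:~R - n%:R = (z - n%:Z)%:~R :> R by rewrite rmorphB.
  exists w.
    rewrite /= mem_lattice_box; apply/forallP => i; rewrite !ffunE.
    have /andP[h1 h2] := h i; case: ifPn => [h3|_]; last by lia.
    have : u i - n%:Z <= Num.floor (tnth x i) by rewrite floor_ge_int -iB.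
    have : Num.floor (tnth x i) < u i + n%:Z by rewrite floor_lt_int -iN.
    by lia.
  rewrite unit_cubeE /= => i; rewrite ffunE; have /andP[h1 h2] := h i.
  case: ifPn => [h3|]; last first.
    rewrite -leNgt => h3; rewrite !rmorphD rmorphN/= rmorph1.
    by apply/andP; split; lra.
  have /andP[h4] := floor_itv (tnth x i); rewrite rmorphD/= rmorph1 => /ltW h5.
  by rewrite h4 h5.
move=> hx0; have [w [+ hx]] : exists w : lattice d,
    w \in lattice_box [ffun i => u i - n%:Z] (2 * n) /\ unit_cube w x.
  by case: hx0 => w ws hx; exists w.
move: hx; rewrite mem_lattice_box unit_cubeE => /= hx /forallP hw i.
have := hw i; rewrite ffunE => /andP[h1 h2]; have /andP[h3 h4] := hx i.
have : (u i - n%:Z)%:~R <= (w i)%:~R :> R by rewrite ler_int.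
have : (w i + 1)%:~R <= (u i + n%:Z)%:~R :> R by rewrite ler_int; lia.
rewrite rmorphB !rmorphD/= rmorph1 => h5 h6.
by apply/andP; split; lra.
Qed.

(** If the cubes u n + Lambda_n exhaust the space, every unit cube is eventually
    one of those that make up u n + Lambda_n. *)
Lemma lattice_box_lim_inf (u : nat -> lattice d) :
  lim_inf_set (fun n => box (u n) n) = [set: d.-tuple R] ->
  forall w : lattice d, \forall n \near \oo,
    w \in lattice_box [ffun i => u n i - n%:Z] (2 * n).
Proof.
move=> hu w.
(* B_w is in the box as soon as its two opposite corners w and w + 1 are *)
pose w1 : lattice d := [ffun i => w i + 1].
have near_box z : \forall n \near \oo, box (R:=R) (u n) n (embed R z).
  have : lim_inf_set (fun n => box (u n) n) (embed R z) by rewrite hu.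
  by move=> [N _ hN]; exists N => // n /= Nn; exact: hN.
near=> n.
have : box (R:=R) (u n) n (embed R w) by near: n; exact: near_box.
have : box (R:=R) (u n) n (embed R w1) by near: n; exact: near_box.
move=> /mem_box_embed h1 /mem_box_embed h2.
move: h1 h2; rewrite !mem_lattice_box => /forallP h1 /forallP h2.
apply/forallP => i; have := h1 i; have := h2 i; rewrite !ffunE; lia.
Unshelve. all: by end_near. Qed.

Lemma dist_Lambda_ge1 n v : ~ Lambda n (embed R v) -> 1 <= dist (embed R v) (Lambda n).
Proof.
move=> hv; rewrite /dist; apply: lb_le_inf.
  by exists (eucl (embed R v) (embed R 0)), (embed R 0) => //= i;
    rewrite tnth_mktuple ffunE oppr_le0 !ler0n.
move=> _ [y /= hy <-].
have [i hi] : exists i, (n%:Z < `|v i|)%R.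
  apply: contrapT => hn; apply: hv => i /=; rewrite tnth_mktuple -ler_norml.
  rewrite -intr_norm -[n%:R]/(n%:Z%:~R) ler_int leNgt; apply/negP => hi.
  by apply: hn; exists i.
have hy1 : `|tnth y i| <= n%:R by rewrite ler_norml hy.
have hv1 : n%:R + 1 <= `|(v i)%:~R : R|.
  by rewrite -intr_norm -[n%:R + 1]/(n%:Z%:~R + 1%:~R) -rmorphD ler_int; lia.
apply: (@le_trans _ _ `|tnth (embed R v) i - tnth y i|).
  by rewrite (le_trans _ (lerB_dist _ _))// tnth_mktuple; lra.
rewrite /eucl -sqrtr_sqr ler_sqrt; last by rewrite sumr_ge0// => j _; rewrite sqr_ge0.
by rewrite (bigD1 i)//= lerDl sumr_ge0// => j _; exact: sqr_ge0.
Qed.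

Lemma dist_Lambda_le n v w : Lambda n (embed R w) ->
  dist (embed R v) (Lambda n) <= lattice_gap v w.
Proof.
move=> hw; apply: (@le_trans _ _ (eucl (embed R v) (embed R w))); last by rewrite lerDr.
apply: ge_inf; last by exists (embed R w).
by exists 0 => _ [y _ <-]; exact: sqrtr_ge0.
Qed.

End lattice_boxes.

(** * Moments of variables dominated by a sum of majorants *)

Section weighted_power_mean.
Context (R : realType).

Lemma powR_pred (x p : R) : 1 < p -> 0 <= x -> x `^ (p - 1) * x = x `^ p.
Proof.
move=> p1; rewrite le_eqVlt => /predU1P[<-|x0].
  by rewrite mulr0 powR0// gt_eqF// (lt_trans _ p1).
rewrite -[X in _ * X](powRr1 (ltW x0)) -powRD; first by rewrite subrK.
by rewrite (gt_eqF x0) implybT.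
Qed.

(** Young's inequality: the graph of z ^ p lies above its tangent at m. *)
Lemma powR_tangent (z m p : R) : 1 < p -> 0 <= z -> 0 <= m ->
  p * (z * m `^ (p - 1)) <= z `^ p + (p - 1) * m `^ p.
Proof.
move=> p1 z0 m0; have p0 : 0 < p by rewrite (lt_trans _ p1).
have q0 : 0 < p / (p - 1) by rewrite divr_gt0// subr_gt0.
have := @conjugate_powR R z (m `^ (p - 1)) p (p / (p - 1)) z0 (powR_ge0 _ _) p0 q0.
rewrite invf_div -powRrM [(p - 1) * _]mulrC divfK ?gt_eqF ?subr_gt0// => h.
have {}h : z * m `^ (p - 1) <= z `^ p / p + m `^ p * ((p - 1) / p).
  by apply: h; field; rewrite gt_eqF.
rewrite -(ler_pM2l p0) in h; apply: (le_trans h); rewrite le_eqVlt.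
by apply/orP; left; apply/eqP; field; rewrite gt_eqF.
Qed.

(** Jensen's inequality for x ^ p, with the weights b i and the values y i / b i:
    sum the tangent inequality at the weighted mean. *)
Lemma powR_sum_weighted (I : Type) (s : seq I) (y b : I -> R) (p : R) :
  1 < p -> (forall i, 0 <= y i) -> (forall i, 0 < b i) ->
  (\sum_(i <- s) y i) `^ p <=
  (\sum_(i <- s) b i) `^ (p - 1) * \sum_(i <- s) b i * (y i / b i) `^ p.
Proof.
move=> p1 y0 b0; have p0 : 0 < p by rewrite (lt_trans _ p1).
case: s => [|i0 s0]; first by rewrite !big_nil powR0 ?mulr0// gt_eqF.
set s := i0 :: s0; set B := \sum_(i <- s) b i; set S := \sum_(i <- s) y i.
have B0 : 0 < B.
  by rewrite /B big_cons ltr_wpDr// sumr_ge0// => i _; exact: ltW.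
have S0 : 0 <= S by rewrite sumr_ge0.
pose m := S / B; have m0 : 0 <= m by rewrite divr_ge0// ltW.
have SE : S = m * B by rewrite /m divfK// gt_eqF.
have h : p * (S * m `^ (p - 1)) <=
    \sum_(i <- s) b i * (y i / b i) `^ p + (p - 1) * m `^ p * B.
  rewrite {1}/S mulr_suml mulr_sumr [_ * B]mulr_sumr -big_split/=.
  apply: ler_sum => i _.
  have h := powR_tangent p1 (divr_ge0 (y0 i) (ltW (b0 i))) m0.
  rewrite -(ler_pM2l (b0 i)) in h.
  rewrite (_ : p * (y i * _) = b i * (p * (y i / b i * m `^ (p - 1)))).
    by apply: le_trans h _; rewrite mulrDr [b i * (_ * m `^ p)]mulrC.
  by field; rewrite gt_eqF.
have mp : S * m `^ (p - 1) = m `^ p * B.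
  by rewrite SE -(powR_pred p1 m0); ring.
rewrite mp in h.
have {}h : m `^ p * B <= \sum_(i <- s) b i * (y i / b i) `^ p by move: h; lra.
rewrite SE powRM ?(ltW B0)// -(powR_pred p1 (ltW B0)).
by rewrite mulrC -mulrA ler_wpM2l ?powR_ge0// mulrC.
Qed.

End weighted_power_mean.

Section moments.
Context (R : realType) (d : nat) (disp : measure_display)
  (T : measurableType disp) (P : probability T R)
  (Y : lattice d -> lattice d -> {RV P >-> R}) (eps delta c : R).
Hypotheses (d0 : (0 < d)%N) (eps0 : 0 < eps) (delta0 : 0 < delta) (c0 : 0 < c).
Hypothesis hY : majorants Y eps delta c.
Implicit Types (v w : lattice d).

(** The right-hand side of the moment condition on the majorants. *)
Definition decay_rate v w : R := c * lattice_gap R v w `^ (- (3 * d%:R + delta)).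

(* The exponent is kept at most 3, so that (b w) ^ (1 - p) costs at most (b w) ^ - 2
   in the weighted Jensen inequality. *)
Let p : R := 2 + Num.min eps 1.

Let p_gt2 : 2 < p. Proof. by rewrite ltrDl lt_min eps0 ltr01. Qed.
Let p_gt1 : 1 < p. Proof. by rewrite (lt_trans _ p_gt2)// ltr1n. Qed.
Let p_le3 : p <= 3.
Proof. by rewrite /p (_ : 3 = 2 + 1) ?lerD2l ?ge_min ?lexx ?orbT//; lra. Qed.
Let p_le : p <= 2 + eps. Proof. by rewrite lerD2l ge_min lexx. Qed.

Lemma decay_rate_ge0 v w : 0 <= decay_rate v w.
Proof. by rewrite mulr_ge0 ?powR_ge0// ltW. Qed.

Let mY v w : measurable_fun [set: T] (fun t => `|Y v w t|).
Proof. exact: measurableT_comp. Qed.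

Let mpow (X : T -> R) q : measurable_fun [set: T] X ->
  measurable_fun [set: T] (fun t => X t `^ q).
Proof. by move=> mX; apply: (@measurableT_comp _ _ _ _ _ _ (fun x : R => x `^ q)). Qed.

(** Intermediate moments are controlled by x ^ q <= x + x ^ (2 + eps). *)
Lemma majorant_moment v w q : 1 <= q -> q <= 2 + eps ->
  ('E_P[fun t => (`|Y v w t| `^ q)%R] <= (decay_rate v w)%:E)%E.
Proof.
move=> q1 q2; have [Y0 Y1] := hY.
apply: (le_trans _ (Y1 v w)).
have -> : ('E_P[Y v w] = \int[P]_t (`|Y v w t|)%:E)%E.
  rewrite unlock; apply: ae_eq_integral => //; [exact/measurable_EFinP|exact/measurable_EFinP|].
  by apply: filterS (Y0 v w) => t Yt _; rewrite /= ger0_norm.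
have -> : ('E_P[fun t => (Y v w t `^ (2 + eps))%R] =
    \int[P]_t (`|Y v w t| `^ (2 + eps))%:E)%E.
  rewrite unlock; apply: ae_eq_integral => //.
  - by apply/measurable_EFinP; exact: mpow.
  - by apply/measurable_EFinP; exact: mpow.
  - by apply: filterS (Y0 v w) => t Yt _; rewrite /= ger0_norm.
rewrite -ge0_integralD//=; last 2 first.
- exact/measurable_EFinP.
- by apply/measurable_EFinP; exact: mpow.
rewrite unlock; apply: ge0_le_integral => //.
- by apply/measurable_EFinP; exact: mpow.
- by apply: emeasurable_funD; apply/measurable_EFinP => //; exact: mpow.
move=> t _; rewrite -EFinD lee_fin; set y := `|Y v w t|.
have y0 : 0 <= y := normr_ge0 _.
have [y1|y1] := leP y 1.
  apply: (@le_trans _ _ y); last by rewrite lerDl powR_ge0.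
  have [yz|yp] := eqVneq y 0.
    by rewrite yz powR0// gt_eqF// (lt_le_trans _ q1).
  by apply: ge1r_powR => //; rewrite lt_neqAle eq_sym yp y0.
by rewrite (le_trans (ler_powR (ltW y1) q2))// lerDr.
Qed.

Section sum_of_majorants.
Variables (v : lattice d) (D : T -> R) (s : seq (lattice d)).
Hypotheses (mD : measurable_fun [set: T] D)
  (hD : {ae P, forall t, `|D t| <= \sum_(w <- s) `|Y v w t|}).

Lemma sum_majorants_moment1 :
  ('E_P[fun t => `|D t|%R] <= (\sum_(w <- s) decay_rate v w)%:E)%E.
Proof.
apply: (@le_trans _ _ 'E_P[fun t => (\sum_(w <- s) `|Y v w t|)%R])%E.
  apply: expectation_le => //; first exact: measurableT_comp.
  - exact: measurable_sum.
  - by move=> t; rewrite sumr_ge0.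
rewrite unlock; under eq_integral do rewrite -sumEFin.
rewrite ge0_integral_sum//=; last first.
  by move=> w; exact/measurable_EFinP.
rewrite -sumEFin; apply: lee_sum => w _.
have := @majorant_moment v w 1 (lexx _).
rewrite unlock; under eq_integral do rewrite powRr1//.
by apply; exact: (le_trans (ltW p_gt1) p_le).
Qed.

Lemma sum_majorants_moment (b : lattice d -> R) : (forall w, 0 < b w) ->
  ('E_P[fun t => (`|D t| `^ p)%R] <=
   ((\sum_(w <- s) b w) `^ (p - 1) *
    \sum_(w <- s) b w * (b w)^-1 `^ p * decay_rate v w)%:E)%E.
Proof.
move=> b0.
have mt w : measurable_fun [set: T] (fun t => b w * (`|Y v w t| / b w) `^ p).
  by apply: measurable_funM => //; apply: mpow; exact: measurable_funM.
apply: (@le_trans _ _ 'E_P[fun t => ((\sum_(w <- s) b w) `^ (p - 1) *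
    \sum_(w <- s) b w * (`|Y v w t| / b w) `^ p)%R])%E.
  apply: expectation_le => //.
  - by apply: mpow; exact: measurableT_comp.
  - by apply: measurable_funM => //; exact: measurable_sum.
  - move=> t; rewrite mulr_ge0 ?powR_ge0// sumr_ge0// => w _.
    by rewrite mulr_ge0 ?powR_ge0// ltW.
  - apply: filterS hD => t Dt.
    apply: (le_trans _ (powR_sum_weighted s p_gt1 (fun w => normr_ge0 (Y v w t)) b0)).
    by rewrite ge0_ler_powR ?nnegrE ?sumr_ge0// (le_trans _ (ltW p_gt1)).
rewrite unlock; under eq_integral do rewrite EFinM -sumEFin.
have tw0 w t : (0 <= (b w * (`|Y v w t| / b w) `^ p)%:E)%E.
  by rewrite lee_fin mulr_ge0 ?powR_ge0// ltW.
rewrite ge0_integralZl//=; last 3 first.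
- by apply: emeasurable_sum => w; exact/measurable_EFinP.
- by move=> t _; apply: sume_ge0.
- by rewrite lee_fin powR_ge0.
rewrite EFinM; apply: lee_wpmul2l; first by rewrite lee_fin powR_ge0.
rewrite ge0_integral_sum//=; last by move=> w; exact/measurable_EFinP.
rewrite -sumEFin; apply: lee_sum => w _.
under eq_integral => t _.
  rewrite powRM ?invr_ge0 ?(ltW (b0 w))// [X in (_ * X)%R]mulrC mulrA EFinM.
  over.
rewrite ge0_integralZl//=; last 2 first.
- by apply/measurable_EFinP; exact: mpow.
- by rewrite lee_fin mulr_ge0 ?powR_ge0// ltW.
rewrite [leRHS]EFinM; apply: lee_wpmul2l.
  by rewrite lee_fin mulr_ge0 ?powR_ge0// ltW.
have := majorant_moment v w (ltW p_gt1) p_le.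
by rewrite unlock.
Qed.

End sum_of_majorants.

(** The bound is uniform in the set s: the moments of the majorants decay fast
    enough to be summed over the whole lattice. *)
Lemma bounded_moments_of_majorants : exists M : R,
  forall v (D : T -> R) (s : seq (lattice d)), uniq s ->
    measurable_fun [set: T] D ->
    {ae P, forall t, `|D t| <= \sum_(w <- s) `|Y v w t|} ->
    ('E_P[fun t => (`|D t| `^ p)%R] <= M%:E)%E.
Proof.
have de0 : 0 < delta / 3 by rewrite divr_gt0.
have [B B0 hB] := @lattice_sum_le R d (delta / 3) d0 de0.
(* With b w = (1 + |v - w|) ^ - beta and 3 beta = 3 d + delta, both the sum of the
   weights and the sum of the weighted moments converge, as beta > d and p <= 3. *)
pose beta := d%:R + delta / 3.
have beta0 : 0 <= beta by rewrite addr_ge0// ltW.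
exists (B `^ (p - 1) * (c * B)) => v D s us mD hD.
pose b w := lattice_gap R v w `^ (- beta).
have b0 w : 0 < b w by rewrite powR_gt0// lattice_gap_gt0.
apply: (le_trans (sum_majorants_moment mD hD b0)); rewrite lee_fin.
apply: ler_pM.
- exact: powR_ge0.
- apply: sumr_ge0 => w _; apply: mulr_ge0; last exact: decay_rate_ge0.
  by rewrite mulr_ge0 ?powR_ge0.
- rewrite ge0_ler_powR ?nnegrE ?subr_ge0 ?(ltW p_gt1)//; last exact: hB.
  by rewrite sumr_ge0// => w _; exact: ltW.
apply: (@le_trans _ _ (\sum_(w <- s) c * b w)); last first.
  by rewrite -mulr_sumr ler_wpM2l ?(ltW c0)// hB.
apply: ler_sum => w _.
have g1 := lattice_gap_ge1 R v w; have g0 := lattice_gap_gt0 R v w.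
rewrite /decay_rate mulrCA ler_wpM2l ?(ltW c0)//.
rewrite -mulrA ler_piMr ?powR_ge0// /b -powRN opprK -powRrM.
rewrite -powRD ?(gt_eqF g0) ?implybT//.
apply: (@le_trans _ _ (lattice_gap R v w `^ 0)); last by rewrite powRr0.
rewrite ler_powR//.
have -> : 3 * d%:R + delta = beta * 3 by rewrite /beta; field.
by rewrite -mulrBr mulr_ge0_le0// subr_le0.
Qed.

(** When all the points of s are at distance at least r, it suffices to count them;
    Jensen's inequality is used with unit weights, and size s ^ p <= size s ^ 3. *)
Lemma moment_decay_of_majorants v (D : T -> R) (s : seq (lattice d)) (r : R) :
  uniq s -> (0 < size s)%N -> measurable_fun [set: T] D ->
  {ae P, forall t, `|D t| <= \sum_(w <- s) `|Y v w t|} ->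
  0 < r -> (forall w, w \in s -> r <= lattice_gap R v w) ->
  ('E_P[fun t => (`|D t| + `|D t| `^ p)%R] <=
   (2 * c * (size s)%:R ^+ 3 * r `^ (- (3 * d%:R + delta)))%:E)%E.
Proof.
move=> us s0 mD hD r0 hr.
have g0 : 0 <= 3 * d%:R + delta by rewrite addr_ge0 ?mulr_ge0// ltW.
set N : R := (size s)%:R; set q := r `^ _.
have N1 : 1 <= N by rewrite ler1n.
have sum_rate : \sum_(w <- s) decay_rate v w <= c * N * q.
  apply: (@le_trans _ _ (\sum_(w <- s) c * q)).
    rewrite !big_seq; apply: ler_sum => w ws.
    rewrite /decay_rate /q ler_wpM2l ?(ltW c0)// !powRN lef_pV2 ?posrE ?powR_gt0 ?lattice_gap_gt0//.
    by rewrite ge0_ler_powR ?nnegrE ?hr ?(ltW r0) ?(ltW (lattice_gap_gt0 _ _ _)).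
  by rewrite big_const_seq count_predT iter_addr_0 -mulr_natr mulrAC.
have h1 := sum_majorants_moment1 mD hD.
have h2 := sum_majorants_moment mD hD (fun _ : lattice d => @ltr01 R).
have e2 : (\sum_(w <- s) (1 : R)) `^ (p - 1) *
    \sum_(w <- s) 1 * 1^-1 `^ p * decay_rate v w <= c * N ^+ 3 * q.
  rewrite big_const_seq count_predT iter_addr_0 -/N.
  under eq_bigr do rewrite invr1 powR1 !mul1r.
  apply: (@le_trans _ _ (N `^ (p - 1) * (c * N * q))).
    by rewrite ler_wpM2l ?powR_ge0.
  have -> : N `^ (p - 1) * (c * N * q) = c * (N `^ (p - 1) * N) * q by ring.
  rewrite powR_pred// ?(le_trans _ N1)//.
  rewrite ler_wpM2r ?powR_ge0// ler_wpM2l ?(ltW c0)//.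
  by rewrite -powR_mulrn ?(le_trans _ N1)// ler_powR.
have e1 : \sum_(w <- s) decay_rate v w <= c * N ^+ 3 * q.
  apply: (le_trans sum_rate); rewrite ler_wpM2r ?powR_ge0// ler_wpM2l ?(ltW c0)//.
  by rewrite -[leLHS]expr1 ler_weXn2l.
have -> : 2 * c * N ^+ 3 * q = c * N ^+ 3 * q + c * N ^+ 3 * q by ring.
rewrite unlock; under eq_integral do rewrite EFinD.
rewrite ge0_integralD//=; last 2 first.
- by apply/measurable_EFinP; exact: measurableT_comp.
- by apply/measurable_EFinP; apply: mpow; exact: measurableT_comp.
rewrite EFinD; apply: leeD.
  by move: h1; rewrite unlock => /le_trans; apply; rewrite lee_fin.
by move: h2; rewrite unlock => /le_trans; apply; rewrite lee_fin.
Qed.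

Lemma moments_of_box_majorants (W W' : (d.-tuple R -> R) -> T -> R)
    (F : set (d.-tuple R) -> noise R d -> R) :
  (forall v n, (0 < n)%N ->
     measurable_fun [set: T] (Delta W W' F v (Lambda n))) ->
  (forall v n, (0 < n)%N -> {ae P, forall t, `|Delta W W' F v (Lambda n) t| <=
     \sum_(w <- lattice_box [ffun i => (0 : lattice d) i - n%:Z] (2 * n).+1) `|Y v w t|}) ->
  bounded_moments P W W' F /\ moment_decay P W W' F.
Proof.
move=> mD hD.
have e0 : 0 < Num.min eps 1 by rewrite lt_min eps0 ltr01.
split.
  have [M hM] := bounded_moments_of_majorants.
  exists (Num.min eps 1); split => //.
  apply: (@le_lt_trans _ _ M%:E); last exact: ltry.
  apply: ge_ereal_sup => _ [v [n [n0 ->]]].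
  by apply: (hM _ _ _ (uniq_lattice_box _ _)); [exact: mD|exact: hD].
exists (2 * c * 27 ^+ d), (Num.min eps 1), (3 * d%:R), (3 * d%:R + delta).
have dR : 0 < d%:R :> R by rewrite ltr0n.
split => //.
- by rewrite !mulr_gt0// exprn_gt0.
- by rewrite mulr_gt0.
- rewrite gt_max ltrDl delta0 andbT (@le_lt_trans _ _ (3 * d%:R))// ?ltrDl//.
  by rewrite ler_peMl// ler1n.
move=> n v n0 vn.
have r1 := dist_Lambda_ge1 vn.
have r0 : 0 < dist (embed R v) (Lambda n) by rewrite (lt_le_trans _ r1).
set s := lattice_box [ffun i => (0 : lattice d) i - n%:Z] (2 * n).+1.
have ss : size s = ((2 * n).+1 ^ d)%N by rewrite size_lattice_box.
apply: le_trans (moment_decay_of_majorants (s := s)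
  (r := dist (embed R v) (Lambda n)) _ _ (mD v n n0) (hD v n n0) r0 _) _.
- exact: uniq_lattice_box.
- by rewrite ss expn_gt0.
- move=> w ws.
  have : box (R:=R) (0 : lattice d) n (embed R w) by apply/mem_box_embed.
  by rewrite box0E => hw; exact: dist_Lambda_le.
rewrite lee_fin ler_wpM2r ?powR_ge0// -!mulrA ler_wpM2l// ler_wpM2l ?(ltW c0)//.
rewrite -(natrM R 3 d) powR_mulrn// ss.
have -> : 27 ^+ d * n%:R ^+ (3 * d) = ((3 * n) ^ d)%:R ^+ 3 :> R.
  rewrite !natrX natrM -exprM [(d * 3)%N]mulnC exprMn [3 ^+ (3 * d)]exprM.
  by rewrite -(natrX R 3 3).
by rewrite -!natrX ler_nat leq_exp2r// leq_exp2r//; lia.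
Qed.

End moments.

(** * Stabilisation *)

Section random_series.
Context (R : realType) (disp : measure_display) (T : measurableType disp)
  (P : probability T R).

(** A series of random variables whose first moments are summable has a sum Z, and
    a variable that agrees with the partial sums up to terms of index at least m is
    close to Z in probability, by Markov's inequality. *)
Lemma random_series (x : nat -> T -> R) (r : nat -> R) :
  (forall k, measurable_fun [set: T] (x k)) -> (forall k, 0 <= r k) ->
  (forall k, 'E_P[fun t => `|x k t|%R] <= (r k)%:E)%E ->
  (\sum_(0 <= k <oo) (r k)%:E < +oo)%E ->
  exists Z : {RV P >-> R}, forall (D : T -> R) (m : nat) (e : R),
    measurable_fun [set: T] D -> 0 < e ->
    {ae P, forall t, \forall N \near \oo,
      `|D t - \sum_(0 <= k < N) x k t| <= \sum_(m <= k < N) `|x k t|} ->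
    (P [set t | (e <= `|D t - Z t|)%R] <= (e^-1)%:E * \sum_(m <= k <oo) (r k)%:E)%E.
Proof.
move=> mx r0 xr rfin.
pose S (t : T) N : R := \sum_(0 <= k < N) x k t.
pose G m t : \bar R := (\sum_(m <= k <oo) (`|x k t|)%:E)%E.
pose Z t : R := fine (limn_esup (fun N => (S t N)%:E)).
have mabs k : measurable_fun [set: T] (fun t => (`|x k t|)%:E).
  by apply/measurable_EFinP; exact: measurableT_comp.
have mS N : measurable_fun [set: T] (fun t => (S t N)%:E).
  by apply/measurable_EFinP; exact: measurable_sum.
have mZ : measurable_fun [set: T] Z.
  apply: (measurableT_comp (f := @fine R)) => //.
  exact: measurable_fun_limn_esup.
have Geq m t : G m t = (\sum_(0 <= k <oo) (`|x (k + m)%N t|)%:E)%E.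
  by rewrite /G -(nneseries_addn m (f := fun k => (`|x k t|)%:E)).
have mG m : measurable_fun [set: T] (G m).
  rewrite (_ : G m = fun t => (\sum_(0 <= k <oo) (`|x (k + m)%N t|)%:E)%E); last first.
    by apply/funext => t; rewrite Geq.
  by apply: ge0_emeasurable_sum.
have intG m : (\int[P]_t G m t <= \sum_(m <= k <oo) (r k)%:E)%E.
  under eq_integral do rewrite Geq.
  rewrite integral_nneseries//=.
  rewrite -(nneseries_addn m (f := fun k => (r k)%:E))//.
  apply: lee_nneseries => k _ ; first by move=> _; exact: integral_ge0.
  by have := xr (k + m)%N; rewrite unlock.
have G0 m t : (0 <= G m t)%E by apply: nneseries_ge0.
have Gfin : {ae P, forall t, (G 0%N t < +oo)%E}.
  have iG : P.-integrable [set: T] (G 0%N).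
    apply/integrableP; split => //.
    under eq_integral do rewrite gee0_abs//.
    exact: le_lt_trans (intG 0%N) rfin.
  apply: filterS (integrable_ae measurableT iG) => t /(_ Logic.I).
  by rewrite ge0_fin_numE.
have ScvgZ : {ae P, forall t, S t N @[N --> \oo] --> Z t}.
  apply: filterS Gfin => t Gt.
  have c1 : cvgn (series (fun k => `|x k t|)) by apply: nnseries_is_cvg.
  have c2 : cvgn (series (x^~ t)) by apply: normed_cvg.
  have c3 : (S t N)%:E @[N --> \oo] --> (limn (series (x^~ t)))%:E.
    by apply: cvg_EFin; [exact: nearW|exact: c2].
  by rewrite /Z (cvg_limn_einf_sup c3).2.
pose Z' : {RV P >-> R} :=
  HB.pack_for {mfun T >-> R} Z (isMeasurableFun.Build _ _ _ _ Z mZ).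
exists Z' => D m e mD e0 hD.
set A := [set t | _].
have mA : measurable A.
  rewrite [A](_ : _ = (fun t => `|D t - Z t|) @^-1` `[e, +oo[%classic).
    have mDZ : measurable_fun [set: T] (fun t => `|D t - Z t|).
      by apply: measurableT_comp => //; exact: measurable_funB.
    by rewrite -[X in measurable X]setTI; exact: mDZ.
  by apply/seteqP; split=> t; rewrite /A /= in_itv/= andbT.
have le1 : (e%:E * P A <= \sum_(m <= k <oo) (r k)%:E)%E.
  apply: le_trans (intG m).
  rewrite -[X in (_ * P X)%E]setIT -integral_indic// -ge0_integralZl//=; last 2 first.
  - by apply/measurable_EFinP; exact: measurable_indic.
  - by rewrite lee_fin ltW.
  apply: ae_ge0_le_integral => //.
  - by move=> t _; rewrite -EFinM lee_fin mulr_ge0// ltW.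
  - by apply/measurable_EFinP; apply: measurable_funM => //; exact: measurable_indic.
  apply: filterS2 hD ScvgZ => t Dt Zt _.
  have DZ : (`|D t - Z t|%:E <= G m t)%E.
    have c : `|D t - S t N|%:E @[N --> \oo] --> `|D t - Z t|%:E.
      apply: cvg_EFin; first exact: nearW.
      by apply: cvg_norm; apply: cvgB => //; exact: cvg_cst.
    rewrite -(cvg_lim _ c)//; apply: lime_le; first by apply/cvg_ex; eexists; exact: c.
    apply: filterS Dt => N DN.
    apply: (@le_trans _ _ (\sum_(m <= k < N) `|x k t|)%:E); first by rewrite lee_fin.
    by rewrite -sumEFin; apply: nneseries_lim_ge.
  apply: le_trans DZ; rewrite -EFinM lee_fin indicE.
  have [At|At] := pselect (A t); first by rewrite mem_set// mulr1.
  by rewrite memNset// mulr0.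
rewrite -(lee_pmul2l _ (_ : 0 < e%:E)%E) ?fin_numE//.
by rewrite muleA -EFinM divff ?gt_eqF// mul1e.
Qed.

End random_series.

Section countable_almost_everywhere.
Context (R : realType) (disp : measure_display) (T : measurableType disp)
  (P : {measure set T -> \bar R}) (I : countType).

Lemma ae_forall_count (Q : I -> T -> Prop) :
  (forall w, {ae P, forall t, Q w t}) -> {ae P, forall t, forall w, Q w t}.
Proof.
move=> h.
have : {ae P, forall t, forall n, if @pickle_inv I n is Some w then Q w t else True}.
  apply: ae_foralln => n; case: (@pickle_inv I n) => [w|]; first exact: h.
  exact: aeW.
by apply: filterS => t ht w; have := ht (pickle w); rewrite pickleK_inv.
Qed.

End countable_almost_everywhere.

Section functional.
Context (R : realType) (d : nat) (disp : measure_display)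
  (T : measurableType disp) (P : probability T R)
  (W W' : (d.-tuple R -> R) -> T -> R)
  (F : set (d.-tuple R) -> noise R d -> R).
Hypotheses (hW : white_noise P W) (hW' : independent_copy P (@L2 R d) W W').
Implicit Types (v w : lattice d).

Lemma measurable_Delta v D : measurable_functional (F D) ->
  measurable_fun [set: T] (Delta W W' F v D).
Proof.
move=> mF; apply: measurable_funB => _ B mB; rewrite setTI.
  by have [] := resample_law hW hW' v (mF B mB).
by have [] := resample_law hW hW' v (mF B mB).
Qed.

Hypotheses (hF : defined_on_cubes F) (hadd : additive_on_cubes P W F).

Lemma cubes1 w : cubes [:: w] = unit_cube w :> set (d.-tuple R).
Proof.
apply/seteqP; split=> x; first by move=> [w' /=]; rewrite inE => /eqP ->.
by move=> wx; exists w => //=; rewrite inE.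
Qed.

Lemma measurable_functional_unit_cube w : measurable_functional (F (unit_cube w)).
Proof. by rewrite -cubes1; exact: hF. Qed.

(** Additivity on cubes is a property of the law of W on cylinder sets; the
    resampled noise has the same law, so the differences are additive too. *)
Lemma Delta_cubes v (s : seq (lattice d)) : s != [::] -> uniq s ->
  {ae P, forall t, Delta W W' F v (cubes s) t =
    \sum_(w <- s) Delta W W' F v (unit_cube w) t}.
Proof.
move=> s0 us.
pose E := [set o : noise R d | F (cubes s) o = \sum_(w <- s) F (unit_cube w) o].
have cE : cylinder (@finite_borel R d) E.
  pose G := [set E : set (noise R d) | exists2 i, @finite_borel R d i &
        exists2 B : set R, measurable B & E = [set w | B (w i)]].
  have mF D : measurable_functional (F D) ->
      measurable_fun [set: g_sigma_algebraType G]
        (fun o : g_sigma_algebraType G => F D o).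
    by move=> mFD _ B mB; rewrite setTI; exact: mFD.
  have mdiff : measurable_fun [set: g_sigma_algebraType G]
      (fun o : g_sigma_algebraType G => F (cubes s) o - \sum_(w <- s) F (unit_cube w) o).
    apply: measurable_funB; first by apply: mF; exact: hF.
    by apply: measurable_sum => w; apply: mF; exact: measurable_functional_unit_cube.
  have := mdiff measurableT [set 0] (measurable_set1 _).
  rewrite setTI (_ : _ @^-1` _ = E)//; apply/seteqP; split=> o /=.
    by move=> /eqP; rewrite subr_eq0 => /eqP.
  by move=> ->; rewrite subrr.
have [mE1 mE2 PE] := resample_law hW hW' v cE.
have aeE : {ae P, forall t, E (set_noise W t)}.
  by apply: filterS hadd => t ht; exact: ht.
have P1 : P [set t | E (set_noise W t)] = 1%E.
  have PC : P (~` [set t | E (set_noise W t)]) = 0%E.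
    have [N [mN N0 sN]] := aeE.
    by apply: subset_measure0 N0 => //; exact: measurableC.
  have fA : P [set t | E (set_noise W t)] \is a fin_num by exact: fin_num_measure.
  have := probability_setC P mE1; rewrite PC -(fineK fA) -EFinB => -[] /eqP.
  by rewrite eq_sym subr_eq0 => /eqP <-.
have aeE' : {ae P, forall t, E (resample v (set_noise W t) (set_noise W' t))}.
  exists (~` [set t | E (resample v (set_noise W t) (set_noise W' t))]); split => //.
  - exact: measurableC.
  - by rewrite probability_setC// -PE P1 subee.
apply: filterS2 aeE aeE' => t e1 e2.
by rewrite /Delta sumrB -e1 -e2.
Qed.

Lemma Delta_box_le (Y : lattice d -> lattice d -> {RV P >-> R}) v n :
  (forall w, {ae P, forall t, `|Delta W W' F v (unit_cube w) t| <= Y v w t}) ->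
  (0 < n)%N -> {ae P, forall t,
  `|Delta W W' F v (Lambda n) t| <=
  \sum_(w <- lattice_box [ffun i => (0 : lattice d) i - n%:Z] (2 * n).+1) `|Y v w t|}.
Proof.
move=> hDY n0; rewrite -box0E box_cubes//.
set s := lattice_box _ (2 * n).
have us : uniq s by exact: uniq_lattice_box.
have s0 : s != [::] by rewrite -size_eq0 size_lattice_box -lt0n expn_gt0 muln_gt0 n0.
apply: filterS2 (Delta_cubes v s0 us) (ae_forall_count hDY) => t -> ht.
apply: (le_trans (ler_norm_sum _ _ _)).
apply: (@le_trans _ _ (\sum_(w <- s) `|Y v w t|)).
  by apply: ler_sum => w _; rewrite (le_trans (ht w))// ler_norm.
apply: sum_sub_le => //; first exact: uniq_lattice_box.
move=> w; rewrite !mem_lattice_box => /forallP h; apply/forallP => i.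
by have := h i; set z := [ffun _ => _] i; lia.
Qed.

Context (Y : lattice d -> lattice d -> {RV P >-> R}) (eps delta c : R).
Hypotheses (d0 : (0 < d)%N) (eps0 : 0 < eps) (delta0 : 0 < delta) (c0 : 0 < c).
Hypothesis hY : majorants Y eps delta c.
Hypothesis hDY : forall v w, {ae P, forall t,
  `|Delta W W' F v (unit_cube w) t| <= Y v w t}.

(** The limit is the sum over the whole lattice of the differences of the unit
    cubes. Once the box contains the first m unit cubes of the enumeration, its
    difference agrees with the partial sums up to terms of index at least m. *)
Lemma stabilisation_of_majorants : stabilisation P W W' F.
Proof.
pose X (w : lattice d) t := Delta W W' F 0 (unit_cube w) t.
have mX w : measurable_fun [set: T] (X w).
  by apply: measurable_Delta; exact: measurable_functional_unit_cube.
pose r (w : lattice d) := decay_rate delta c 0 w.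
have r0 w : 0 <= r w by exact: decay_rate_ge0.
have EX w : ('E_P[fun t => `|X w t|%R] <= (r w)%:E)%E.
  have := @sum_majorants_moment1 R d disp T P Y eps delta c eps0 hY 0 (X w) [:: w] (mX w).
  rewrite big_seq1; apply.
  by apply: filterS (hDY 0 w) => t Xt; rewrite big_seq1 (le_trans Xt)// ler_norm.
(* the lattice is enumerated by its canonical injection into nat; the indices that
   do not code a lattice point contribute the default value z *)
pose opt (A : Type) (z : A) (f : lattice d -> A) k :=
  if @pickle_inv (lattice d) k is Some w then f w else z.
pose I N : seq (lattice d) := pmap (@pickle_inv (lattice d)) (iota 0 N).
have uI N : uniq (I N).
  by apply: pmap_uniq (iota_uniq _ _); exact: pickle_invK.
have sumI (f : lattice d -> R) N :
    \sum_(0 <= k < N) opt R 0 f k = \sum_(w <- I N) f w.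
  rewrite /I /index_iota subn0; elim: (iota 0 N) => [|k s IH]; first by rewrite !big_nil.
  rewrite big_cons IH /= /opt; case: (pickle_inv k) => [w|]; first by rewrite /= big_cons.
  by rewrite /= add0r.
have memI w N : (w \in I N) = (pickle w < N)%N.
  rewrite /I mem_pmap; apply/mapP/idP => [[k]|h].
    rewrite mem_iota add0n => /andP[_ kN] e.
    by have := pickle_invK (T := lattice d) k; rewrite -e /= => ->.
  by exists (pickle w); rewrite ?mem_iota ?pickleK_inv.
(* 3 d + delta = d + (2 d + delta) *)
have de0 : 0 < 2 * d%:R + delta by rewrite ltr_wpDl// mulr_ge0.
have [B B0 hB] := @lattice_sum_le R d (2 * d%:R + delta) d0 de0.
have rfin : (\sum_(0 <= k <oo) (opt R 0 r k)%:E < +oo)%E.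
  apply: (@le_lt_trans _ _ (c * B)%:E); last exact: ltry.
  have opt0 k : 0 <= opt R 0 r k by rewrite /opt; case: pickle_inv.
  apply: lime_le.
    by apply: is_cvg_nneseries => k _ _; rewrite lee_fin.
  apply: nearW => N; rewrite sumEFin lee_fin sumI /r /decay_rate -mulr_sumr.
  rewrite ler_wpM2l ?(ltW c0)//.
  have -> : 3 * d%:R + delta = d%:R + (2 * d%:R + delta) by ring.
  exact: hB.
have [|k|k|Z hZ] := @random_series R disp T P (opt (T -> R) (cst 0) X) (opt R 0 r) _ _ _ rfin.
- by move=> k; rewrite /opt; case: pickle_inv => // w.
- by rewrite /opt; case: pickle_inv.
- rewrite /opt; case: pickle_inv => [w|]; first exact: EX.
  rewrite unlock; under eq_integral do rewrite /= normr0.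
  by rewrite integral0.
exists Z => u hu e e0.
pose s n := lattice_box [ffun i => u n i - n%:Z] (2 * n).
have PN n m : (0 < n)%N -> {subset I m <= s n} ->
    (P [set t | (e <= `|Delta W W' F 0 (box (u n) n) t - Z t|)%R] <=
     (e^-1)%:E * \sum_(m <= k <oo) (opt R 0 r k)%:E)%E.
  move=> n0 Ims.
  have us : uniq (s n) by exact: uniq_lattice_box.
  have s0 : s n != [::] by rewrite -size_eq0 size_lattice_box -lt0n expn_gt0 muln_gt0 n0.
  apply: hZ => //.
    by rewrite box_cubes//; apply: measurable_Delta; exact: hF.
  rewrite box_cubes//; apply: filterS (Delta_cubes 0 s0 us) => t ->.
  pose N0 := (\max_(w <- s n) (pickle w).+1)%N.
  exists (maxn m N0) => // N /=; rewrite geq_max => /andP[mN N0N].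
  have sN : {subset s n <= I N}.
    move=> w ws; rewrite memI (leq_trans _ N0N)//.
    by rewrite /N0 (big_rem w)//= leq_max ltnS leqnn.
  have optE (k : nat) : opt (T -> R) (cst 0) X k t = opt R 0 (X^~ t) k.
    by rewrite /opt; case: pickle_inv.
  have optN (k : nat) : `|opt (T -> R) (cst 0) X k t| = opt R 0 (fun w => `|X w t|) k.
    by rewrite /opt; case: pickle_inv => //=; rewrite normr0.
  have splitI (f : lattice d -> R) (l : seq (lattice d)) : uniq l -> {subset l <= I N} ->
      \sum_(w <- I N) f w = \sum_(w <- l) f w + \sum_(w <- I N | w \notin l) f w.
    move=> ul lI; rewrite (bigID (mem l))/=; congr (_ + _).
    rewrite -big_filter; apply: perm_big; apply: uniq_perm => //.
      exact: filter_uniq.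
    by move=> w; rewrite mem_filter/=; case: (boolP (w \in l)) => // /lI ->.
  under [X in `|_ - X|]eq_bigr do rewrite optE.
  rewrite sumI (splitI (X^~ t) _ us sN) opprD addNKr.
  rewrite normrN; apply: (le_trans (ler_norm_sum _ _ _)).
  under [leRHS]eq_bigr do rewrite optN.
  have -> : \sum_(m <= k < N) opt R 0 (fun w => `|X w t|) k =
      \sum_(w <- I N | w \notin I m) `|X w t|.
    have ImN : {subset I m <= I N} by move=> w /Ims /sN.
    have := sumI (fun w => `|X w t|) N.
    rewrite (splitI _ _ (uI m) ImN) -sumI (@big_cat_nat _ _ _ m)//=.
    by move=> /addrI.
  rewrite [leLHS]big_mkcond [leRHS]big_mkcond; apply: ler_sum => w _.
  case: ifPn => [ws|_]; last by case: ifP.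
  by case: ifPn => // /negPn /Ims; rewrite (negbTE ws).
have tail0 := nneseries_tail_cvg rfin.
have {}tail0 : (\sum_(m <= k <oo) (opt R 0 r k)%:E @[m --> \oo] --> 0)%E.
  by apply: tail0 => k _; rewrite lee_fin /opt; case: pickle_inv.
have {}tail0 : (((e^-1)%:E * \sum_(m <= k <oo) (opt R 0 r k)%:E) @[m --> \oo] --> 0)%E.
  have /(cvgeZl (y := (e^-1)%:E)) : (e^-1)%:E \is a fin_num by [].
  by move=> /(_ _ _ _ _ tail0); rewrite mule0.
apply/fine_cvgP; split.
  near=> n; rewrite fin_num_measure//.
  have n0 : (0 < n)%N by near: n; exists 1%N.
  have mD : measurable_fun [set: T] (Delta W W' F 0 (box (u n) n)).
    by rewrite box_cubes//; apply: measurable_Delta; apply: hF;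
      rewrite -size_eq0 size_lattice_box -lt0n expn_gt0 muln_gt0 n0.
  rewrite (_ : [set _ | _] =
    (fun t => `|Delta W W' F 0 (box (u n) n) t - Z t|) @^-1` `[e, +oo[%classic).
    have mDZ : measurable_fun [set: T] (fun t => `|Delta W W' F 0 (box (u n) n) t - Z t|).
      by apply: measurableT_comp => //; exact: measurable_funB.
    by rewrite -[X in measurable X]setTI; exact: mDZ.
  by apply/seteqP; split=> t; rewrite /= in_itv/= andbT.
apply/cvgr0Pnorm_le => eta eta0.
have [m tm] : exists m : nat,
    ((e^-1)%:E * \sum_(m <= k <oo) (opt R 0 r k)%:E < eta%:E)%E.
  have /fine_cvgP[tfin /cvgr0Pnorm_lt /(_ eta eta0) tlt] := tail0.
  near \oo => m.
  exists m.
  have fm : ((e^-1)%:E * \sum_(m <= k <oo) (opt R 0 r k)%:E)%E \is a fin_num by near: m.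
  rewrite -(fineK fm) lte_fin (le_lt_trans (ler_norm _))//.
  by near: m.
have near_sub : \forall n \near \oo, {subset I m <= s n}.
  elim: (I m) => [|w l IH]; first by apply: nearW => n w.
  apply: filterS2 (lattice_box_lim_inf hu w) IH => n wn ln z.
  by rewrite inE => /orP[/eqP ->|/ln].
near=> n.
have n0 : (0 < n)%N by near: n; exists 1%N.
have sub : {subset I m <= s n} by near: n; exact: near_sub.
have h := PN n m n0 sub.
rewrite /= ger0_norm ?fine_ge0//.
rewrite -lee_fin fineK; first exact: (le_trans h (ltW tm)).
rewrite ge0_fin_numE//; apply: le_lt_trans h (lt_trans tm _); exact: ltry.
Unshelve. all: by end_near. Qed.

End functional.

(** * The proposition *)

Theorem proposition2p6 (R : realType) (d : nat) (disp : measure_display)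
    (T : measurableType disp) (P : probability T R)
    (W W' : (d.-tuple R -> R) -> T -> R)
    (F : set (d.-tuple R) -> noise R d -> R) :
  (0 < d)%N ->
  white_noise P W ->
  independent_copy P (@L2 R d) W W' ->
  stationary_functional P W F ->
  (defined_on_cubes F ->
   additive_on_cubes P W F ->
   forall (Y : lattice d -> lattice d -> {RV P >-> R}) (eps delta c : R),
     0 < eps -> 0 < delta -> 0 < c ->
     majorants Y eps delta c ->
     (forall v w, {ae P, forall t,
        `|Delta W W' F v (unit_cube w) t| <= Y v w t}) ->
     [/\ stabilisation P W W' F,
         bounded_moments P W W' F &
         moment_decay P W W' F])
  /\
  (forall (Y : lattice d -> lattice d -> {RV P >-> R}) (eps delta c : R),
     0 < eps -> 0 < delta -> 0 < c ->
     majorants Y eps delta c ->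
     (forall v u n, (0 < n)%N -> {ae P, forall t,
        `|Delta W W' F v (box u n) t| <=
        \sum_(w \in [set w | box u n (embed R w)]) Y v w t}) ->
     bounded_moments P W W' F /\ moment_decay P W W' F).
Proof.
move=> d0 hW hW' [mF _].
have mLambda v n : (0 < n)%N -> measurable_fun [set: T] (Delta W W' F v (Lambda n)).
  by move=> n0; rewrite -box0E; apply: (measurable_Delta hW hW'); exact: mF.
split=> [hF hadd|] Y eps delta c eps0 delta0 c0 hY hD.
  have [] := moments_of_box_majorants d0 eps0 delta0 c0 hY mLambda.
    by move=> v n n0; exact: (Delta_box_le hW hW' hF hadd (hD v)).
  by split => //; exact: (stabilisation_of_majorants hW hW' hF hadd d0 eps0 delta0 c0 hY hD).
apply: (moments_of_box_majorants d0 eps0 delta0 c0 hY mLambda) => v n n0.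
rewrite -box0E; apply: filterS (hD v 0 n n0) => t ht.
apply: (le_trans ht).
rewrite [X in \sum_(w \in X) _](_ : _ =
  [set` lattice_box [ffun i => (0 : lattice d) i - n%:Z] (2 * n).+1]).
  rewrite -fsbig_seq ?uniq_lattice_box//.
  by apply: ler_sum => w _; exact: ler_norm.
by apply/seteqP; split=> w /= /mem_box_embed.
Qed.
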